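(* For every $\varepsilon>0$ there exists $\delta=\delta(\varepsilon)>0$ such that the following holds for every $n\ge1$. Let $\phi_1,\phi_2,\phi_3:\mathbb{R}^n\to\{-1,1\}$ be measurable functions such that for all $1\le i\ne j\le 3$ and all $u\in\{-1,1\}$, $$\mathbb{P}[\phi_i(\mathcal{N}_i)=u]+\mathbb{P}[\phi_j(\mathcal{N}_j)=-u]\ \ge\ 2\varepsilon .$$ Then $$\mathbb{P}[\phi_1(\mathcal{N}_1)=\phi_2(\mathcal{N}_2)=\phi_3(\mathcal{N}_3)]\ \ge\ \delta .$$ Moreover, one may take $\delta=(\varepsilon/2)^{18}$.
   Context: $N=(N_1,N_2,N_3)$ is a centered jointly Gaussian vector with $\mathbb{E}[N_1^2]=\mathbb{E}[N_2^2]=\mathbb{E}[N_3^2]=1$ and $\mathbb{E}[N_1N_2]=\mathbb{E}[N_2N_3]=\mathbb{E}[N_3N_1]=-1/3$. $N(1),\dots,N(n)$ are independent copies of $N$, and $\mathcal{N}_i=(N(1)_i,\dots,N(n)_i)\in\mathbb{R}^n$ for $1\le i\le3$. *)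

(* Defs.v *)
From HB Require Import structures.
From mathcomp Require Import all_boot all_order all_algebra.
From mathcomp Require Import all_classical all_reals all_analysis.

Set Implicit Arguments.
Unset Strict Implicit.
Unset Printing Implicit Defensive.

Import Order.TTheory GRing.Theory Num.Theory.
Import numFieldNormedType.Exports.

Local Open Scope classical_set_scope.
Local Open Scope ring_scope.

(* R^n is [n.-tuple R] with the product sigma-algebra of the library, i.e. its
   Borel sigma-algebra. *)

Definition mutually_independent (d d' : measure_display)
    (T : measurableType d) (T' : measurableType d') (R : realType)
    (P : probability T R) (I : finType) (X : I -> T -> T') : Prop :=
  forall (J : {set I}) (B : I -> set T'), (forall i, measurable (B i)) ->
    P [set w | forall i, i \in J -> B i (X i w)]
    = (\prod_(i in J) P (X i @^-1` B i))%E.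

(* The laws are only compared on measurable sets: the values of a measure on
   other sets are meaningless. *)
Definition same_law (d1 d2 d' : measure_display)
    (T1 : measurableType d1) (T2 : measurableType d2) (T' : measurableType d')
    (R : realType) (P1 : probability T1 R) (P2 : probability T2 R)
    (X1 : T1 -> T') (X2 : T2 -> T') : Prop :=
  forall B : set T', measurable B -> P1 (X1 @^-1` B) = P2 (X2 @^-1` B).

Definition standard_normal (d : measure_display) (T : measurableType d)
    (R : realType) (P : probability T R) (Z : T -> R) : Prop :=
  forall B : set R, measurable B -> P (Z @^-1` B) = normal_prob 0 1 B.

(* X has the law of m + A Z, where Z has independent standard normal
   coordinates; degenerate Gaussian vectors are included. Z may live on another
   probability space, as that of X may be too small to carry it. *)
Definition jointly_gaussian (d : measure_display) (T : measurableType d)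
    (R : realType) (P : probability T R) (p : nat) (X : T -> p.-tuple R)
    : Prop :=
  exists (l : nat) (m : 'I_p -> R) (A : 'M[R]_(p, l))
    (d0 : measure_display) (T0 : measurableType d0) (P0 : probability T0 R)
    (Z : 'I_l -> {RV P0 >-> R}),
    [/\ mutually_independent P0 (fun j => Z j : T0 -> R),
        forall j, standard_normal P0 (Z j) &
        same_law P P0 X
          (fun w => [tuple m i + \sum_(j < l) A i j * Z j w | i < p])].

(* The random point of R^n collecting the i-th coordinates of n random vectors
   in R^p. *)
Definition coordinates (T : Type) (R : realType) (n p : nat)
    (X : 'I_n -> T -> p.-tuple R) (i : 'I_p) (w : T) : n.-tuple R :=
  [tuple tnth (X k w) i | k < n].

(* The three functions are phi i for i : 'I_3, and {-1, 1} is taken inside R. *)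
Definition paradox_bound (R : realType) (eps delta : R) : Prop :=
  forall (n : nat), (1 <= n)%N ->
  forall (d : measure_display) (T : measurableType d) (P : probability T R)
    (N : {RV P >-> 3.-tuple R}) (Ncopy : 'I_n -> {RV P >-> 3.-tuple R}),
    jointly_gaussian P N ->
    (forall i : 'I_3, 'E_P[(fun w => tnth (N w) i)] = 0)%E ->
    (forall i : 'I_3, 'E_P[(fun w => tnth (N w) i ^+ 2)%R] = 1)%E ->
    (forall i j : 'I_3, i != j ->
       'E_P[(fun w => tnth (N w) i * tnth (N w) j)%R] = (- (1 / 3))%:E)%E ->
    (forall k, same_law P P (Ncopy k) N) ->
    mutually_independent P (fun k => Ncopy k : T -> 3.-tuple R) ->
  forall phi : 'I_3 -> n.-tuple R -> R,
    (forall i, measurable_fun [set: n.-tuple R] (phi i)) ->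
    (forall i x, phi i x = -1 \/ phi i x = 1) ->
    let calN := coordinates (fun k => Ncopy k : T -> 3.-tuple R) in
    (forall (i j : 'I_3) (u : R), i != j -> u = -1 \/ u = 1 ->
       ((2 * eps)%:E <= P [set w | phi i (calN i w) = u]
                        + P [set w | phi j (calN j w) = (- u)%R])%E) ->
    (delta%:E <= P [set w | forall i j : 'I_3,
                              phi i (calN i w) = phi j (calN j w)])%E.

(* Main.v *)
Require Import Defs.
From mathcomp Require Import all_boot all_order all_algebra.
From mathcomp Require Import all_classical all_reals all_analysis.
From mathcomp Require Import measurable_realfun ring lra.

Set Implicit Arguments.
Unset Strict Implicit.
Unset Printing Implicit Defensive.

Import Order.TTheory GRing.Theory Num.Theory.
Import numFieldNormedType.Exports.
Local Open Scope classical_set_scope.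
Local Open Scope ring_scope.

(** Proof idea. Call a triple (X, Y, Z) good when
      E[f(X)^6 g(Y)^6 h(Z)^6] >= E[f(X)]^6 E[g(Y)]^6 E[h(Z)]^6
    for all measurable f, g, h with values in [0, 1]: reverse Hoelder with
    exponent 1/6. The hypothesis yields a sign u taken by each phi_i with
    probability at least eps, and goodness applied to the indicators of
    phi_i = u gives the bound eps^18. Goodness tensorizes by Fubini, so one
    coordinate (N_1, N_2, N_3) suffices. There, for C^{1,1} functions, a second
    order expansion shows that the inequality for f(x + tau N_1), g(y + tau N_2),
    h(z + tau N_3) holds up to an error o(tau^2), since the covariance matrix is
    at least 1/6. As (N + N')/sqrt 2 has the law of N, passing from tau to
    sqrt 2 tau only doubles the error; starting from tau = 2^{-r/2} and letting r
    go to infinity removes it. Finally every measurable function with values in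
    [0, 1] is an L^1 limit of C^{1,1} ones. *)

(** * Means of functions with values in [0, 1] *)

(** Sixth powers replace sixth roots, so that all expansions are polynomial and an indicator is its
    own sixth power. With an exponent p in place of 6, the second order gap between the two sides
    is, in relative increments, p^2/2 times the quadratic form of the covariance matrix minus 1/p.
    That matrix has eigenvalues 1/3, 4/3, 4/3, so p = 6 leaves room. The doubling shapes the rest.
    After r doublings the local error is multiplied by 2^r = tau^{-2}, so it has to be o(tau^2)
    uniformly over a class of functions that is stable under averaging over shifts by tau N. This is
    why the class is given by a bound [C] on a first order expansion: averaging preserves [C], and
    the local error depends on the functions through [C] alone. Only second moments of the
    coordinates are at hand, so the cubic remainder is cut off to M^2 min(1, tau M), where M is the
    sum of the absolute values of the coordinates; its mean tends to 0 by dominated convergence.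
    Gaussianity enters only through the invariance of the law under (N + N')/sqrt 2. *)

Definition unit_fun (d : measure_display) (T : measurableType d) (R : realType)
    (f : T -> R) : Prop :=
  measurable_fun setT f /\ forall x, 0 <= f x <= 1.

Section Mean.
Context d (T : measurableType d) (R : realType) (P : probability T R).
Implicit Types f g : T -> R.

Lemma bounded_integrable f (M : R) : measurable_fun setT f ->
  (forall x, `|f x| <= M) -> P.-integrable setT (EFin \o f).
Proof.
move=> mf fM; apply: (@le_integrable _ _ _ P setT _ _ (EFin \o cst M)) => //.
- exact/measurable_EFinP.
- move=> x _ /=; rewrite lee_fin; apply: (le_trans (fM x)); exact: ler_norm.
- exact: finite_measure_integrable_cst.
Qed.

Lemma mean_cst (c : R) : \int[P]_x c = c.
Proof.
rewrite Rintegral_cst//; transitivity (c * fine (1%E : \bar R)); last by rewrite mulr1.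
by congr (_ * fine _); exact: probability_setT.
Qed.

Lemma unit_integrable f : unit_fun f -> P.-integrable setT (EFin \o f).
Proof.
case=> mf f01; apply: (@bounded_integrable f 1) => // x.
by have /andP[f0 f1] := f01 x; rewrite ger0_norm.
Qed.

Lemma mean_le f g : P.-integrable setT (EFin \o f) ->
  P.-integrable setT (EFin \o g) -> (forall x, f x <= g x) ->
  \int[P]_x f x <= \int[P]_x g x.
Proof. by move=> intf intg fg; exact: le_Rintegral. Qed.

Lemma unit_mean f : unit_fun f -> 0 <= \int[P]_x f x <= 1.
Proof.
move=> uf; have intf := unit_integrable uf; case: uf => mf f01.
apply/andP; split; first by apply: Rintegral_ge0 => x _; case/andP: (f01 x).
rewrite -[leRHS]mean_cst; apply: mean_le => //.
  exact: finite_measure_integrable_cst.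
by move=> x; case/andP: (f01 x).
Qed.

Lemma mean_dominated_cvg (f_ : nat -> T -> R) f g :
  (forall n, measurable_fun setT (f_ n)) -> P.-integrable setT (EFin \o g) ->
  (forall n x, `|f_ n x| <= g x) -> (forall x, f_ ^~ x @ \oo --> f x) ->
  \int[P]_x f_ n x @[n --> \oo] --> \int[P]_x f x.
Proof.
move=> mf intg fg f_f.
have cvgE : (\int[P]_x (f_ n x)%:E @[n --> \oo] --> \int[P]_x (f x)%:E)%E.
  apply: (@dominated_cvg _ _ _ P setT measurableT _ _ (EFin \o g)) => //.
  - by move=> n; exact/measurable_EFinP.
  - by move=> x _; apply/cvg_EFin; [exact: nearW|exact: f_f].
  - by move=> n x _ /=; rewrite lee_fin.
have mf' : measurable_fun setT f by apply: (measurable_fun_cvg (h := f_)).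
have intf : P.-integrable setT (EFin \o f).
  apply: le_integrable intg => //; first exact/measurable_EFinP.
  move=> x _ /=; rewrite lee_fin; apply: (@le_trans _ _ (g x)); last exact: ler_norm.
  have f_fx : `|f_ n x| @[n --> \oo] --> `|f x| by exact: (cvg_norm (f_f x)).
  by apply: (ler_cvg_to f_fx (cvg_cst (g x))); exact: nearW.
have fin_f : (\int[P]_x (f x)%:E)%E \is a fin_num by exact: integrable_fin_num.
by move: cvgE; rewrite -(fineK fin_f) => /fine_cvg.
Qed.

End Mean.

Section UnitFun.
Context d (T : measurableType d) (R : realType).
Implicit Types f g : T -> R.

Lemma unit_comp d' (T' : measurableType d') f (k : T' -> T) :
  unit_fun f -> measurable_fun setT k -> unit_fun (f \o k).
Proof. by move=> [mf f01] mk; split=> [|x]; [exact: measurableT_comp|exact: f01]. Qed.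

Lemma unitM f g : unit_fun f -> unit_fun g -> unit_fun (fun x => f x * g x).
Proof.
move=> [mf f01] [mg g01]; split; first exact: measurable_funM.
move=> x; have /andP[? ?] := f01 x; have /andP[? ?] := g01 x.
by rewrite mulr_ge0//= mulr_ile1.
Qed.

Lemma unitX f n : unit_fun f -> unit_fun (fun x => f x ^+ n).
Proof.
move=> [mf f01]; split; first exact: measurable_funX.
by move=> x; have /andP[? ?] := f01 x; rewrite exprn_ge0//= exprn_ile1.
Qed.

Lemma unit_onem f : unit_fun f -> unit_fun (fun x => 1 - f x).
Proof.
move=> [mf f01]; split; first exact: measurable_funB.
by move=> x; have /andP[? ?] := f01 x; lra.
Qed.

Lemma unit_indic (A : set T) : measurable A -> unit_fun (\1_A : T -> R).
Proof.
move=> mA; split; first exact: measurable_indic.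
by move=> x; rewrite indicE; case: (x \in A) => /=; lra.
Qed.

End UnitFun.

Section Fubini.
Context d1 d2 (T1 : measurableType d1) (T2 : measurableType d2) (R : realType).
Variables (P : probability T1 R) (Q : probability T2 R).

Lemma unit_mean2 (f : T1 * T2 -> R) : unit_fun f ->
  unit_fun (fun x => \int[Q]_y f (x, y)).
Proof.
move=> uf; have ux x : unit_fun (fun y => f (x, y)).
  by apply: (unit_comp uf); exact: measurable_pair1.
split; last by move=> x; exact: unit_mean.
case: uf => mf f01.
apply: measurableT_comp => //=.
apply: (@measurable_fun_fubini_tonelli_F _ _ T1 T2 R Q (EFin \o f)).
  exact/measurable_EFinP.
by move=> x /=; rewrite lee_fin; case/andP: (f01 x).
Qed.

Lemma measurable_mean2 (f : T1 * T2 -> R) (M : R) : measurable_fun setT f ->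
  (forall z, `|f z| <= M) -> measurable_fun setT (fun x => \int[Q]_y f (x, y)).
Proof.
move=> mf fM.
(* An affine rescaling brings [f] into [0, 1], where [unit_mean2] applies; adding 1 makes the
   divisor positive even if [M] is 0. *)
pose M' := `|M| + 1; have M'0 : 0 < M' by rewrite /M'; have := normr_ge0 M; lra.
pose g z := (f z / M' + 1) / 2.
have ug : unit_fun g.
  split.
    apply: measurable_funM => //; apply: measurable_funD => //.
    exact: measurable_funM.
  move=> z; have : `|f z / M'| <= 1.
    rewrite normrM normfV (gtr0_norm M'0) ler_pdivrMr// mul1r.
    by apply: (le_trans (fM z)); rewrite /M'; have := ler_norm M; lra.
  by rewrite ler_norml /g => /andP[? ?]; lra.
have -> : (fun x => \int[Q]_y f (x, y)) =
          (fun x => (2 * M') * (\int[Q]_y g (x, y)) - M').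
  apply/funext => x.
  have ux : unit_fun (fun y => g (x, y)).
    by apply: (unit_comp ug); exact: measurable_pair1.
  rewrite -RintegralZl//; last exact: unit_integrable.
  rewrite -[X in _ - X](mean_cst Q) -RintegralB//.
  - apply: eq_Rintegral => y _; rewrite /g; field; exact: lt0r_neq0.
  - have := unit_integrable Q ux => /(integrableZl measurableT (2 * M')).
    by apply: eq_integrable => // y _.
  - exact: finite_measure_integrable_cst.
by apply: measurable_funB => //; apply: measurable_funM => //; case: (unit_mean2 ug).
Qed.

Lemma unit_fubini (f : T1 * T2 -> R) : unit_fun f ->
  \int[P]_x (\int[Q]_y f (x, y)) = \int[(P \x Q)%E]_z f z.
Proof.
move=> uf; have [mf f01] := uf.
rewrite /Rintegral fubini_tonelli1//=.
- congr fine; apply: eq_integral => x _ /=.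
  rewrite fineK// /fubini_F; apply: integrable_fin_num => //.
  apply: (@unit_integrable _ _ _ Q (fun y => f (x, y))).
  by apply: (unit_comp uf); exact: measurable_pair1.
- exact/measurable_EFinP.
- by move=> x /=; rewrite lee_fin; case/andP: (f01 x).
Qed.

Lemma unit_fubini_swap (f : T1 * T2 -> R) : unit_fun f ->
  \int[P]_x (\int[Q]_y f (x, y)) = \int[Q]_y (\int[P]_x f (x, y)).
Proof.
move=> uf; have [mf f01] := uf; rewrite unit_fubini// /Rintegral fubini_tonelli2//=.
- congr fine; apply: eq_integral => y _ /=.
  rewrite fineK// /fubini_G; apply: integrable_fin_num => //.
  apply: (@unit_integrable _ _ _ P (fun x => f (x, y))).
  by apply: (unit_comp uf); exact: measurable_pair2.
- exact/measurable_EFinP.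
- by move=> x /=; rewrite lee_fin; case/andP: (f01 x).
Qed.

End Fubini.

(** * Second order expansion of the sixth powers *)

Section Jet.
Variable R : realFieldType.
Implicit Types K D A p q s : R.

(* [A = p + q + s + O(D^3)], where [p], [q], [s] have order 0, 1, 2 in [D]. *)
Definition jet K D A p q s : Prop :=
  [/\ `|p| <= K, `|q| <= K * D, `|s| <= K * D ^+ 2 &
      `|A - (p + q + s)| <= K * D ^+ 3].

Lemma ler_normM (a b x y : R) : `|a| <= x -> `|b| <= y -> `|a * b| <= x * y.
Proof. by move=> ax byy; rewrite normrM; apply: ler_pM. Qed.

(** The constant 10 is 4 + 3 + 3 in the remainder: the error of [A] times [A'], bounded by 4 K'; the
    jet of [A], bounded by 3 K, times the error of [A']; and the three products of total order at
    least 3. *)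
Lemma jetM K K' D A A' p p' q q' s s' : 0 <= D <= 1 -> 0 <= K -> 0 <= K' ->
  jet K D A p q s -> jet K' D A' p' q' s' ->
  jet (10 * (K * K')) D (A * A') (p * p') (p * q' + q * p')
    (p * s' + q * q' + s * p').
Proof.
move=> /andP[D0 D1] K0 K'0 [hp hq hs hA] [hp' hq' hs' hA'].
have KK : 0 <= K * K' by rewrite mulr_ge0.
have D2 : D ^+ 2 <= 1 by rewrite exprn_ile1.
have D20 : 0 <= D ^+ 2 by rewrite exprn_ge0.
have D30 : 0 <= D ^+ 3 by rewrite exprn_ge0.
have D3 : D ^+ 3 <= 1 by rewrite exprn_ile1.
have D43 : D ^+ 4 <= D ^+ 3 by rewrite ler_wiXn2l.
have b11 := ler_normM hp hp'.
have b12 := ler_normM hp hq'.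
have b21 := ler_normM hq hp'.
have b13 := ler_normM hp hs'.
have b22 := ler_normM hq hq'.
have b31 := ler_normM hs hp'.
have b23 := ler_normM hq hs'.
have b32 := ler_normM hs hq'.
have b33 := ler_normM hs hs'.
have KD : K * K' * D <= K * K' by rewrite ler_piMr.
have KD1 : 0 <= K * K' * D by rewrite mulr_ge0.
have KD2 : 0 <= K * K' * D ^+ 2 by rewrite mulr_ge0.
have KD3 : 0 <= K * K' * D ^+ 3 by rewrite mulr_ge0.
have KD4 : K * K' * D ^+ 4 <= K * K' * D ^+ 3 by rewrite ler_wpM2l.
have hJ : `|p + q + s| <= K * 3.
  have : K * D <= K by rewrite ler_piMr.
  have : K * D ^+ 2 <= K by rewrite ler_piMr.
  have := ler_normD (p + q) s; have := ler_normD p q; lra.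
have hA4 : `|A'| <= K' * 4.
  have : K' * D <= K' by rewrite ler_piMr.
  have : K' * D ^+ 2 <= K' by rewrite ler_piMr.
  have : K' * D ^+ 3 <= K' by rewrite ler_piMr.
  have := ler_normD (p' + q') s'; have := ler_normD p' q'.
  have := ler_normD (A' - (p' + q' + s')) (p' + q' + s').
  by rewrite subrK; lra.
have c1 := ler_normM hA hA4.
have c2 := ler_normM hJ hA'.
split.
- lra.
- by have := ler_normD (p * q') (q * p'); lra.
- have := ler_normD (p * s' + q * q') (s * p').
  by have := ler_normD (p * s') (q * q'); lra.
- have -> : A * A' - (p * p' + (p * q' + q * p') + (p * s' + q * q' + s * p')) =
    (A - (p + q + s)) * A' + (p + q + s) * (A' - (p' + q' + s'))
    + (q * s' + s * q' + s * s') by ring.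
  have e1 := ler_normD ((A - (p + q + s)) * A' + (p + q + s) * (A' - (p' + q' + s')))
    (q * s' + s * q' + s * s').
  have e2 := ler_normD ((A - (p + q + s)) * A') ((p + q + s) * (A' - (p' + q' + s'))).
  have e3 := ler_normD (q * s' + s * q') (s * s').
  have e4 := ler_normD (q * s') (s * q').
  lra.
Qed.

Lemma jet_eq K D A p q s K' A' p' q' s' : jet K D A p q s ->
  K = K' -> A = A' -> p = p' -> q = q' -> s = s' -> jet K' D A' p' q' s'.
Proof. by move=> J <- <- <- <- <-. Qed.

Lemma jetX6 K D A p q s : 0 <= D <= 1 -> 0 <= K -> jet K D A p q s ->
  jet (10 ^+ 5 * K ^+ 6) D (A ^+ 6) (p ^+ 6) (6 * p ^+ 5 * q)
    (6 * p ^+ 5 * s + 15 * p ^+ 4 * q ^+ 2).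
Proof.
move=> D01 K0 J.
have K20 : 0 <= 10 * (K * K) by rewrite !mulr_ge0.
have K30 : 0 <= 10 * (10 * (K * K) * K) by rewrite !mulr_ge0.
have J2 := jetM D01 K0 K0 J J.
have J3 := jetM D01 K20 K0 J2 J.
have J6 := jetM D01 K30 K30 J3 J3.
by apply: (jet_eq J6); ring.
Qed.

(** Two more uses of [jetM] on three sixth powers, each with constant 10^5 K^6, give 10^(15 + 2)
    K^18. The order 2 part separates the second order terms of the factors from the products of
    first order terms, which become [quad6]. *)
Lemma jet_prod6 K D A p q s B p1 q1 s1 C p2 q2 s2 : 0 <= D <= 1 -> 0 <= K ->
  jet K D A p q s -> jet K D B p1 q1 s1 -> jet K D C p2 q2 s2 ->
  jet (10 ^+ 17 * K ^+ 18) D (A ^+ 6 * B ^+ 6 * C ^+ 6)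
    (p ^+ 6 * p1 ^+ 6 * p2 ^+ 6)
    (6 * p ^+ 5 * p1 ^+ 6 * p2 ^+ 6 * q + 6 * p ^+ 6 * p1 ^+ 5 * p2 ^+ 6 * q1 +
     6 * p ^+ 6 * p1 ^+ 6 * p2 ^+ 5 * q2)
    (6 * p ^+ 5 * p1 ^+ 6 * p2 ^+ 6 * s + 6 * p ^+ 6 * p1 ^+ 5 * p2 ^+ 6 * s1 +
     6 * p ^+ 6 * p1 ^+ 6 * p2 ^+ 5 * s2 +
     (15 * p ^+ 4 * p1 ^+ 6 * p2 ^+ 6 * q ^+ 2 +
      15 * p ^+ 6 * p1 ^+ 4 * p2 ^+ 6 * q1 ^+ 2 +
      15 * p ^+ 6 * p1 ^+ 6 * p2 ^+ 4 * q2 ^+ 2 +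
      36 * p ^+ 5 * p1 ^+ 5 * p2 ^+ 6 * (q * q1) +
      36 * p ^+ 6 * p1 ^+ 5 * p2 ^+ 5 * (q1 * q2) +
      36 * p ^+ 5 * p1 ^+ 6 * p2 ^+ 5 * (q * q2))).
Proof.
move=> D01 K0 /(jetX6 D01 K0) J /(jetX6 D01 K0) J1 /(jetX6 D01 K0) J2.
have L0 : 0 <= 10 ^+ 5 * K ^+ 6 by rewrite mulr_ge0 ?exprn_ge0.
have M0 : 0 <= 10 * ((10 ^+ 5 * K ^+ 6) * (10 ^+ 5 * K ^+ 6)) by rewrite !mulr_ge0.
have J01 := jetM D01 L0 L0 J J1.
have J012 := jetM D01 M0 L0 J01 J2.
by apply: (jet_eq J012); ring.
Qed.

End Jet.

Section Taylor.
Variable R : realFieldType.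
Implicit Types a b c x y z : R.

Definition lin6 a b c x y z : R :=
  6 * a ^+ 5 * b ^+ 6 * c ^+ 6 * x + 6 * a ^+ 6 * b ^+ 5 * c ^+ 6 * y +
  6 * a ^+ 6 * b ^+ 6 * c ^+ 5 * z.

(** The second order term of a^6 b^6 c^6. The six products of increments are separate arguments, so
    that the form is linear in them and can be evaluated at their means, which do not factor. *)
Definition quad6 a b c x2 y2 z2 xy yz xz : R :=
  15 * a ^+ 4 * b ^+ 6 * c ^+ 6 * x2 + 15 * a ^+ 6 * b ^+ 4 * c ^+ 6 * y2 +
  15 * a ^+ 6 * b ^+ 6 * c ^+ 4 * z2 + 36 * a ^+ 5 * b ^+ 5 * c ^+ 6 * xy +
  36 * a ^+ 6 * b ^+ 5 * c ^+ 5 * yz + 36 * a ^+ 5 * b ^+ 6 * c ^+ 5 * xz.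

(* The covariance matrix minus 1/6 is positive; this is where the correlation
   -1/3 enters. *)
Lemma quad6_ge0 a b c x y z : quad6 a b c (x ^+ 2) (y ^+ 2) (z ^+ 2)
  (- (1 / 3) * (x * y)) (- (1 / 3) * (y * z)) (- (1 / 3) * (x * z)) >= 0.
Proof.
have -> : quad6 a b c (x ^+ 2) (y ^+ 2) (z ^+ 2)
    (- (1 / 3) * (x * y)) (- (1 / 3) * (y * z)) (- (1 / 3) * (x * z)) =
  3 * (a * b * c) ^+ 4 * ((x * b * c) ^+ 2 + (a * y * c) ^+ 2 + (a * b * z) ^+ 2
    + 2 * (x * b * c - a * y * c) ^+ 2 + 2 * (a * y * c - a * b * z) ^+ 2
    + 2 * (x * b * c - a * b * z) ^+ 2) by rewrite /quad6; field.
apply: mulr_ge0; first by rewrite mulr_ge0// exprn_even_ge0.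
by rewrite !addr_ge0 ?sqr_ge0// mulr_ge0 ?sqr_ge0.
Qed.

Lemma monom_le1 a b c i j k : 0 <= a <= 1 -> 0 <= b <= 1 -> 0 <= c <= 1 ->
  0 <= a ^+ i * b ^+ j * c ^+ k <= 1.
Proof.
move=> /andP[? ?] /andP[? ?] /andP[? ?].
by rewrite !mulr_ge0 ?exprn_ge0//= !mulr_ile1 ?mulr_ge0 ?exprn_ge0 ?exprn_ile1.
Qed.

Lemma norm_monom a b c i j k x : 0 <= a <= 1 -> 0 <= b <= 1 -> 0 <= c <= 1 ->
  `|a ^+ i * b ^+ j * c ^+ k * x| <= `|x|.
Proof.
move=> a01 b01 c01; have /andP[m0 m1] := monom_le1 i j k a01 b01 c01.
by rewrite normrM (ger0_norm m0) ler_piMl.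
Qed.

Lemma norm_lin6 a b c x y z : 0 <= a <= 1 -> 0 <= b <= 1 -> 0 <= c <= 1 ->
  `|lin6 a b c x y z| <= 6 * (`|x| + `|y| + `|z|).
Proof.
move=> a01 b01 c01.
have hx := norm_monom 5 6 6 x a01 b01 c01.
have hy := norm_monom 6 5 6 y a01 b01 c01.
have hz := norm_monom 6 6 5 z a01 b01 c01.
have -> : lin6 a b c x y z = 6 * (a ^+ 5 * b ^+ 6 * c ^+ 6 * x
  + a ^+ 6 * b ^+ 5 * c ^+ 6 * y + a ^+ 6 * b ^+ 6 * c ^+ 5 * z)
  by rewrite /lin6; ring.
rewrite normrM ger0_norm// ler_pM2l//.
move: hx hy hz; set u := _ * x; set v := _ * y; set w := _ * z.
by have := ler_normD (u + v) w; have := ler_normD u v; lra.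
Qed.

(** The constant is the sum of the coefficients: 153 = 3 * 15 + 3 * 36. *)
Lemma norm_quad6 a b c x2 y2 z2 xy yz xz M : 0 <= a <= 1 -> 0 <= b <= 1 ->
  0 <= c <= 1 -> `|x2| <= M -> `|y2| <= M -> `|z2| <= M -> `|xy| <= M ->
  `|yz| <= M -> `|xz| <= M -> `|quad6 a b c x2 y2 z2 xy yz xz| <= 153 * M.
Proof.
move=> a01 b01 c01 h1 h2 h3 h4 h5 h6.
have := norm_monom 4 6 6 x2 a01 b01 c01.
have := norm_monom 6 4 6 y2 a01 b01 c01.
have := norm_monom 6 6 4 z2 a01 b01 c01.
have := norm_monom 5 5 6 xy a01 b01 c01.
have := norm_monom 6 5 5 yz a01 b01 c01.
have := norm_monom 5 6 5 xz a01 b01 c01.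
rewrite /quad6 !ler_norml; do 6 (move=> /andP[? ?]).
apply/andP; split; lra.
Qed.

(** The remainder is D^3 only for D <= 1. For larger D everything on the left is O(D^2) while the
    right side is nonnegative, so D^2 suffices there; the remainder is then integrable with second
    moments only. *)
Lemma taylor6_lower (C : R) : 0 <= C -> exists2 K : R, 0 <= K &
  forall a b c x y z u v w t1 t2 t3 D,
  0 <= a <= 1 -> 0 <= b <= 1 -> 0 <= c <= 1 ->
  0 <= u <= 1 -> 0 <= v <= 1 -> 0 <= w <= 1 ->
  `|x| <= C -> `|y| <= C -> `|z| <= C ->
  `|u - a - x * t1| <= C * t1 ^+ 2 -> `|v - b - y * t2| <= C * t2 ^+ 2 ->
  `|w - c - z * t3| <= C * t3 ^+ 2 ->
  `|t1| <= D -> `|t2| <= D -> `|t3| <= D ->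
  a ^+ 6 * b ^+ 6 * c ^+ 6 + lin6 a b c (u - a) (v - b) (w - c)
  + quad6 a b c (x ^+ 2 * t1 ^+ 2) (y ^+ 2 * t2 ^+ 2) (z ^+ 2 * t3 ^+ 2)
      (x * y * (t1 * t2)) (y * z * (t2 * t3)) (x * z * (t1 * t3))
  - K * (D ^+ 2 * Num.min 1 D) <= u ^+ 6 * v ^+ 6 * w ^+ 6.
Proof.
move=> C0.
pose K1 : R := 10 ^+ 17 * (1 + C) ^+ 18.
have C10 : 0 <= 1 + C by lra.
have K10 : 0 <= K1 by apply: mulr_ge0; apply: exprn_ge0.
(* [K1] is the constant of [jet_prod6] and settles D <= 1. For D > 1, the bounds 1 on the monomial,
   18 on [lin6] and 153 C^2 D^2 on [quad6] give the rest. *)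
exists (K1 + 19 + 153 * C ^+ 2); first by rewrite !addr_ge0// mulr_ge0 ?sqr_ge0.
move=> a b c x y z u v w t1 t2 t3 D a01 b01 c01 u01 v01 w01 xC yC zC hu hv hw
  t1D t2D t3D.
have D0 : 0 <= D := le_trans (normr_ge0 _) t1D.
have sqD t : `|t| <= D -> t ^+ 2 <= D ^+ 2.
  by move=> tD; rewrite -real_normK ?num_real// lerXn2r ?nnegrE.
have [D1|D1] := leP D 1.
  (* The order 2 part is the whole deviation from the tangent line, so the jet is exact. The first
     and second order parts then recombine to u - a inside [lin6]. *)
  have J (a' x' t u' : R) : 0 <= a' <= 1 -> `|x'| <= C ->
      `|u' - a' - x' * t| <= C * t ^+ 2 -> `|t| <= D ->
      jet (1 + C) D u' a' (x' * t) (u' - a' - x' * t).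
    move=> /andP[a'0 a'1] x'C u't tD; split.
    - by rewrite ger0_norm//; lra.
    - rewrite normrM; apply: ler_pM => //; lra.
    - apply: (le_trans u't); apply: ler_pM => //; [exact: sqr_ge0|lra|exact: sqD].
    - have -> : u' - (a' + x' * t + (u' - a' - x' * t)) = 0 by ring.
      by rewrite normr0 mulr_ge0 ?exprn_ge0 ?addr_ge0.
  have D01 : 0 <= D <= 1 by rewrite D0.
  have [_ _ _] := jet_prod6 D01 C10 (J _ _ _ _ a01 xC hu t1D)
    (J _ _ _ _ b01 yC hv t2D) (J _ _ _ _ c01 zC hw t3D).
  rewrite ler_distl => /andP[low _]; apply: le_trans low.
  have -> : D ^+ 2 * D = D ^+ 3 by ring.
  have D3 : 0 <= D ^+ 3 by rewrite exprn_ge0.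
  have ineq : K1 * D ^+ 3 <= (K1 + 19 + 153 * C ^+ 2) * D ^+ 3.
    by rewrite ler_wpM2r// -addrA lerDl addr_ge0// mulr_ge0// sqr_ge0.
  apply: lerB => //.
  rewrite -subr_ge0 [leRHS](_ : _ = 0)//.
  by rewrite /lin6 /quad6; ring.
have D1' := ltW D1.
have D21 : 1 <= D ^+ 2 by rewrite exprn_ege1.
have uvw0 : 0 <= u ^+ 6 * v ^+ 6 * w ^+ 6.
  by case/andP: (monom_le1 6 6 6 u01 v01 w01).
apply: le_trans uvw0.
have /andP[_ abc1] := monom_le1 6 6 6 a01 b01 c01.
have l6 := norm_lin6 (u - a) (v - b) (w - c) a01 b01 c01.
have dist1 (u' a' : R) : 0 <= u' <= 1 -> 0 <= a' <= 1 -> `|u' - a'| <= 1.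
  by move=> /andP[? ?] /andP[? ?]; rewrite ler_norml; lra.
have d1 := dist1 _ _ u01 a01; have d2 := dist1 _ _ v01 b01.
have d3 := dist1 _ _ w01 c01.
have pr (x' y' s t : R) : `|x'| <= C -> `|y'| <= C -> `|s| <= D -> `|t| <= D ->
    `|x' * y' * (s * t)| <= C ^+ 2 * D ^+ 2.
  by move=> ? ? ? ?; rewrite !expr2; apply: ler_normM; exact: ler_normM.
have q6 := norm_quad6 a01 b01 c01 (pr _ _ _ _ xC xC t1D t1D)
  (pr _ _ _ _ yC yC t2D t2D) (pr _ _ _ _ zC zC t3D t3D)
  (pr _ _ _ _ xC yC t1D t2D) (pr _ _ _ _ yC zC t2D t3D)
  (pr _ _ _ _ xC zC t1D t3D).
rewrite !expr2 in q6 *.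
have KD : 0 <= K1 * (D * D) by rewrite !mulr_ge0.
move: l6 q6; rewrite !ler_norml => /andP[_ l6] /andP[_ q6].
rewrite mulr1; rewrite expr2 in D21; lra.
Qed.

(** Meant for u, v, w the means of the shifted functions: these lie within O(tau^2) of a, b, c, so
    the squared error is O(tau^4). *)
Lemma taylor6_upper : exists2 K : R, 0 <= K & forall a b c u v w,
  0 <= a <= 1 -> 0 <= b <= 1 -> 0 <= c <= 1 ->
  0 <= u <= 1 -> 0 <= v <= 1 -> 0 <= w <= 1 ->
  u ^+ 6 * v ^+ 6 * w ^+ 6 <=
    a ^+ 6 * b ^+ 6 * c ^+ 6 + lin6 a b c (u - a) (v - b) (w - c)
    + K * (`|u - a| + `|v - b| + `|w - c|) ^+ 2.
Proof.
pose K1 : R := 10 ^+ 17.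
have K10 : 0 <= K1 by exact: exprn_ge0.
exists (K1 + 172); first by rewrite addr_ge0.
move=> a b c u v w a01 b01 c01 u01 v01 w01.
set D := _ + `|w - c|.
have [[nu nv] nw] := (normr_ge0 (u - a), normr_ge0 (v - b), normr_ge0 (w - c)).
have D0 : 0 <= D by rewrite !addr_ge0.
have [hu hv hw] : [/\ `|u - a| <= D, `|v - b| <= D & `|w - c| <= D].
  by rewrite /D; split; lra.
have D20 : 0 <= D ^+ 2 by exact: sqr_ge0.
have [D1|D1] := leP D 1.
  have J (a' u' : R) : 0 <= a' <= 1 -> `|u' - a'| <= D ->
      jet 1 D u' a' (u' - a') 0.
    move=> /andP[a'0 a'1] u'D; split.
    - by rewrite ger0_norm.
    - by rewrite mul1r.
    - by rewrite normr0 mul1r.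
    - have -> : u' - (a' + (u' - a') + 0) = 0 by ring.
      by rewrite normr0 mul1r exprn_ge0.
  have D01 : 0 <= D <= 1 by rewrite D0.
  have [_ _ _ jetD] := jet_prod6 D01 ler01 (J _ _ a01 hu) (J _ _ b01 hv) (J _ _ c01 hw).
  have pr (s t : R) : `|s| <= D -> `|t| <= D -> `|s * t| <= D ^+ 2.
    by rewrite expr2; exact: ler_normM.
  have quadD := norm_quad6 a01 b01 c01 (pr _ _ hu hu) (pr _ _ hv hv) (pr _ _ hw hw)
    (pr _ _ hu hv) (pr _ _ hv hw) (pr _ _ hu hw).
  move: quadD; rewrite /quad6 -!expr2 ler_norml => /andP[_ q6].
  move: jetD; rewrite expr1n mulr1 -/K1 ler_distl => /andP[_ up].
  apply: (le_trans up); rewrite /lin6.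
  have D3 : K1 * D ^+ 3 <= K1 * D ^+ 2.
    by rewrite ler_wpM2l// exprS ler_piMl.
  lra.
have D1' := ltW D1.
have D21 : 1 <= D ^+ 2 by rewrite exprn_ege1.
have /andP[_ uvw1] := monom_le1 6 6 6 u01 v01 w01.
have /andP[abc0 _] := monom_le1 6 6 6 a01 b01 c01.
have := norm_lin6 (u - a) (v - b) (w - c) a01 b01 c01.
rewrite -/D ler_norml => /andP[l6 _].
have DD : D <= D ^+ 2 by rewrite expr2 ler_peMl.
have KD : 0 <= K1 * D ^+ 2 by rewrite mulr_ge0.
lra.
Qed.

(** Used both at the means and pointwise under the integral, to carry the inequality over to L^1
    limits. *)
Lemma monom6_lip a b c u v w : 0 <= a <= 1 -> 0 <= b <= 1 -> 0 <= c <= 1 ->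
  0 <= u <= 1 -> 0 <= v <= 1 -> 0 <= w <= 1 ->
  `|a ^+ 6 * b ^+ 6 * c ^+ 6 - u ^+ 6 * v ^+ 6 * w ^+ 6| <=
  6 * (`|a - u| + `|b - v| + `|c - w|).
Proof.
have X6 x y : 0 <= x <= 1 -> 0 <= y <= 1 -> `|x ^+ 6 - y ^+ 6| <= 6 * `|x - y|.
  move=> x01 y01.
  have m i j : `|x ^+ i * y ^+ j| <= 1.
    have o01 : 0 <= (1 : R) <= 1 by rewrite ler01 lexx.
    have /andP[] := monom_le1 i j 0 x01 y01 o01.
    by rewrite expr0 mulr1 => ? ?; rewrite ger0_norm.
  have -> : x ^+ 6 - y ^+ 6 = (x ^+ 5 * y ^+ 0 + x ^+ 4 * y ^+ 1 + x ^+ 3 * y ^+ 2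
    + x ^+ 2 * y ^+ 3 + x ^+ 1 * y ^+ 4 + x ^+ 0 * y ^+ 5) * (x - y) by ring.
  rewrite normrM ler_wpM2r// ler_norml.
  have := (m 5 0, m 4 1, m 3 2, m 2 3, m 1 4, m 0 5)%N.
  rewrite !ler_norml => -[[[[[]]]]].
  by do 6 (move=> /andP[? ?]); lra.
move=> a01 b01 c01 u01 v01 w01.
have := (X6 _ _ a01 u01, X6 _ _ b01 v01, X6 _ _ c01 w01).
have p01 x : 0 <= x <= 1 -> `|x ^+ 6| <= 1.
  by move=> /andP[? ?]; rewrite ger0_norm ?exprn_ge0// exprn_ile1.
case=> -[h1 h2] h3.
have -> : a ^+ 6 * b ^+ 6 * c ^+ 6 - u ^+ 6 * v ^+ 6 * w ^+ 6 =
  (a ^+ 6 - u ^+ 6) * (b ^+ 6 * c ^+ 6) + (b ^+ 6 - v ^+ 6) * (u ^+ 6 * c ^+ 6)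
  + (c ^+ 6 - w ^+ 6) * (u ^+ 6 * v ^+ 6) by ring.
have pr x y z r : `|x| <= r -> 0 <= y <= 1 -> 0 <= z <= 1 ->
    `|x * (y ^+ 6 * z ^+ 6)| <= r.
  move=> xr y01 z01; rewrite -[leRHS]mulr1; apply: ler_normM => //.
  by rewrite -[leRHS]mulr1; apply: ler_normM; exact: p01.
have k1 := pr _ _ _ _ h1 b01 c01; have k2 := pr _ _ _ _ h2 u01 c01.
have k3 := pr _ _ _ _ h3 u01 v01.
move: k1 k2 k3; set X := (_ - _) * _; set Y := (_ - _) * _; set Z := (_ - _) * _.
by have := ler_normD (X + Y) Z; have := ler_normD X Y; lra.
Qed.

End Taylor.

(** * The one-dimensional inequality for smooth functions *)

(** Integrability and value travel together, so that the mean of a long linear combination is built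
    as a single proof term. *)
Definition has_mean (d : measure_display) (T : measurableType d) (R : realType)
    (P : probability T R) (f : T -> R) (m : R) : Prop :=
  P.-integrable setT (EFin \o f) /\ \int[P]_x f x = m.

Section HasMean.
Context d (T : measurableType d) (R : realType) (P : probability T R).
Implicit Types f g : T -> R.
Local Notation has_mean := (has_mean P).

Lemma has_mean_cst c : has_mean (fun=> c) c.
Proof. by split; [exact: finite_measure_integrable_cst|exact: mean_cst]. Qed.

Lemma has_meanD f g a b : has_mean f a -> has_mean g b ->
  has_mean (fun x => f x + g x) (a + b).
Proof.
move=> [intf <-] [intg <-]; split; last by rewrite RintegralD.
have := integrableD measurableT intf intg.
by apply: eq_integrable => // x _.
Qed.

Lemma has_meanZ f a c : has_mean f a -> has_mean (fun x => c * f x) (c * a).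
Proof.
move=> [intf <-]; split; last by rewrite RintegralZl.
have := integrableZl measurableT c intf.
by apply: eq_integrable => // x _.
Qed.

Lemma has_meanN f a : has_mean f a -> has_mean (fun x => - f x) (- a).
Proof.
move=> /(has_meanZ (-1)); rewrite mulN1r; congr has_mean.
by apply/funext => x; rewrite mulN1r.
Qed.

Lemma has_meanB f g a b : has_mean f a -> has_mean g b ->
  has_mean (fun x => f x - g x) (a - b).
Proof. by move=> ff gg; apply: has_meanD => //; exact: has_meanN. Qed.

Lemma has_mean_unit f : unit_fun f -> has_mean f (\int[P]_x f x).
Proof. by move=> uf; split => //; exact: unit_integrable. Qed.

Lemma has_mean_le f g a b : has_mean f a -> has_mean g b ->
  (forall x, f x <= g x) -> a <= b.
Proof. by move=> [intf <-] [intg <-] fg; exact: mean_le. Qed.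

Lemma has_mean_dom f g a : measurable_fun setT f -> has_mean g a ->
  (forall x, `|f x| <= g x) -> has_mean f (\int[P]_x f x).
Proof.
move=> mf [intg _] fg; split => //.
apply: le_integrable intg => //; first exact/measurable_EFinP.
by move=> x _ /=; rewrite lee_fin; apply: (le_trans (fg x)); exact: ler_norm.
Qed.

Lemma has_mean_lin6 a b c f g h u v w : has_mean f u -> has_mean g v ->
  has_mean h w -> has_mean (fun x => lin6 a b c (f x) (g x) (h x)) (lin6 a b c u v w).
Proof.
by move=> hf hg hh; apply: has_meanD; [apply: has_meanD|]; exact: has_meanZ.
Qed.

Lemma has_mean_quad6 a b c f1 f2 f3 f4 f5 f6 u1 u2 u3 u4 u5 u6 :
  has_mean f1 u1 -> has_mean f2 u2 -> has_mean f3 u3 ->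
  has_mean f4 u4 -> has_mean f5 u5 -> has_mean f6 u6 ->
  has_mean (fun x => quad6 a b c (f1 x) (f2 x) (f3 x) (f4 x) (f5 x) (f6 x))
    (quad6 a b c u1 u2 u3 u4 u5 u6).
Proof.
move=> *; rewrite /quad6.
by do 5 (apply: has_meanD; last exact: has_meanZ); exact: has_meanZ.
Qed.

End HasMean.

(** Here [d] plays the role of the derivative, but only a pointwise expansion is required. This
    makes the class stable under integration over a parameter, with the same [C], without
    differentiating under the integral. *)
Definition c11 (R : realType) (C : R) (h : R -> R) : Prop :=
  unit_fun h /\ exists d : R -> R, [/\ measurable_fun setT d,
    forall x, `|d x| <= C &
    forall x t, `|h (x + t) - h x - d x * t| <= C * t ^+ 2].

Lemma sqr_norms_le (R : realDomainType) (a b c : R) :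
  (`|a| + `|b| + `|c|) ^+ 2 <= 3 * (a ^+ 2 + b ^+ 2 + c ^+ 2).
Proof.
rewrite -(real_normK (num_real a)) -(real_normK (num_real b)).
rewrite -(real_normK (num_real c)); move: `|a| `|b| `|c| => x y z.
rewrite -subr_ge0 [leRHS](_ : _ = (x - y) ^+ 2 + (y - z) ^+ 2 + (x - z) ^+ 2);
  last by ring.
by rewrite !addr_ge0 ?sqr_ge0.
Qed.

Section OneDim.
Context d (T : measurableType d) (R : realType) (P : probability T R).
Variables X Y Z : T -> R.
Hypotheses (mX : measurable_fun setT X) (mY : measurable_fun setT Y)
  (mZ : measurable_fun setT Z).
Local Notation has_mean := (has_mean P).
Hypotheses (EX : has_mean X 0) (EY : has_mean Y 0) (EZ : has_mean Z 0).
Hypotheses (EX2 : has_mean (fun w => X w ^+ 2) 1)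
  (EY2 : has_mean (fun w => Y w ^+ 2) 1) (EZ2 : has_mean (fun w => Z w ^+ 2) 1).
Hypotheses (EXY : has_mean (fun w => X w * Y w) (- (1 / 3)))
  (EYZ : has_mean (fun w => Y w * Z w) (- (1 / 3)))
  (EXZ : has_mean (fun w => X w * Z w) (- (1 / 3))).

Let M w := `|X w| + `|Y w| + `|Z w|.

Let M_ge0 w : 0 <= M w.
Proof. by rewrite !addr_ge0. Qed.

Let mM : measurable_fun setT M.
Proof.
by apply: measurable_funD; [apply: measurable_funD|]; exact: measurableT_comp.
Qed.


Let EM2 : has_mean (fun w => M w ^+ 2) (\int[P]_w M w ^+ 2).
Proof.
apply: (has_mean_dom _ (has_meanZ 3 (has_meanD (has_meanD EX2 EY2) EZ2))).
  exact: measurable_funX.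
by move=> w; rewrite ger0_norm ?sqr_ge0//; exact: sqr_norms_le.
Qed.

(** The truncated cubic remainder divided by tau^2. It is dominated by M^2 and vanishes pointwise
    with tau. *)
Definition tail tau w := M w ^+ 2 * Num.min 1 (tau * M w).

Lemma tail_le tau w : 0 <= tau -> `|tail tau w| <= M w ^+ 2.
Proof.
move=> tau0; have m0 : 0 <= Num.min 1 (tau * M w).
  by rewrite le_min ler01 mulr_ge0.
rewrite ger0_norm /tail ?mulr_ge0 ?sqr_ge0//.
by rewrite ler_piMr ?sqr_ge0// ge_min lexx.
Qed.

Lemma measurable_tail tau : measurable_fun setT (tail tau).
Proof.
apply: measurable_funM; first exact: measurable_funX.
by apply: measurable_minr => //; exact: measurable_funM.
Qed.

Lemma mean_tail tau : 0 <= tau -> has_mean (tail tau) (\int[P]_w tail tau w).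
Proof.
move=> tau0; apply: (has_mean_dom _ EM2); first exact: measurable_tail.
by move=> w; exact: tail_le.
Qed.

Lemma measurable_affine (V : T -> R) x tau : measurable_fun setT V ->
  measurable_fun setT (fun w => x + tau * V w).
Proof. by move=> mV; apply: measurable_funD => //; exact: measurable_funM. Qed.

(** The first order term integrates to 0 because [V] is centered, and the quadratic remainder
    integrates to at most C tau^2. *)
Lemma c11_shift_mean C h (V : T -> R) x tau : c11 C h ->
  measurable_fun setT V -> has_mean V 0 -> has_mean (fun w => V w ^+ 2) 1 ->
  `|\int[P]_w h (x + tau * V w) - h x| <= C * tau ^+ 2.
Proof.
move=> [uh [d' [md dC dh]]] mV V0 V1.
have uhV : unit_fun (fun w => h (x + tau * V w)).
  by apply: (unit_comp uh); exact: measurable_affine.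
have H := has_meanB (has_meanB (has_mean_unit P uhV) (has_mean_cst P (h x)))
  (has_meanZ (d' x) (has_meanZ tau V0)).
have H2 := has_meanZ (C * tau ^+ 2) V1.
rewrite !mulr0 subr0 in H; rewrite mulr1 in H2.
rewrite ler_norml; apply/andP; split.
- apply: (has_mean_le (has_meanN H2) H) => w.
  have := dh x (tau * V w); rewrite exprMn (mulrA C) ler_norml => /andP[+ _].
  by [].
- apply: (has_mean_le H H2) => w.
  by have := dh x (tau * V w); rewrite exprMn (mulrA C) ler_norml => /andP[_ +].
Qed.

(** The error [e] is the same for all functions with constant [C] and all base points; iterating the
    inequality needs this uniformity. *)
Definition rev_holder C tau e := forall h1 h2 h3, c11 C h1 -> c11 C h2 ->
  c11 C h3 -> forall x y z,
  (\int[P]_w h1 (x + tau * X w)) ^+ 6 * (\int[P]_w h2 (y + tau * Y w)) ^+ 6 *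
  (\int[P]_w h3 (z + tau * Z w)) ^+ 6 <=
  \int[P]_w (h1 (x + tau * X w) ^+ 6 * h2 (y + tau * Y w) ^+ 6 *
             h3 (z + tau * Z w) ^+ 6) + e.

(** The lower expansion is integrated, the upper one is taken at the means. As [lin6] is linear,
    both produce the same first order term, and their difference is a nonnegative quadratic form
    plus errors: [K1] times the mean of the cubic remainder, and K2 (3 C tau^2)^2 from the
    displacement of the means. *)
Lemma rev_holder_local C : 0 <= C -> exists2 K : R, 0 <= K &
  forall tau, 0 <= tau ->
    rev_holder C tau (K * (tau ^+ 2 * \int[P]_w tail tau w + tau ^+ 4)).
Proof.
move=> C0; have [K1 K10 low] := taylor6_lower C0.
have [K2 K20 upp] := @taylor6_upper R.
exists (K1 + 9 * K2 * C ^+ 2); first by rewrite addr_ge0// !mulr_ge0// sqr_ge0.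
move=> tau tau0 h1 h2 h3 c1 c2 c3 x y z.
have s1 := c11_shift_mean x tau c1 mX EX EX2.
have s2 := c11_shift_mean y tau c2 mY EY EY2.
have s3 := c11_shift_mean z tau c3 mZ EZ EZ2.
have [u1 [d1 [_ dC1 dh1]]] := c1.
have [u2 [d2 [_ dC2 dh2]]] := c2.
have [u3 [d3 [_ dC3 dh3]]] := c3.
have uX : unit_fun (fun w => h1 (x + tau * X w)).
  by apply: (unit_comp u1); exact: measurable_affine.
have uY : unit_fun (fun w => h2 (y + tau * Y w)).
  by apply: (unit_comp u2); exact: measurable_affine.
have uZ : unit_fun (fun w => h3 (z + tau * Z w)).
  by apply: (unit_comp u3); exact: measurable_affine.
have uXYZ := unitM (unitM (unitX 6 uX) (unitX 6 uY)) (unitX 6 uZ).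
have HL := has_meanB (has_meanD (has_meanD
   (has_mean_cst P (h1 x ^+ 6 * h2 y ^+ 6 * h3 z ^+ 6))
   (has_mean_lin6 (h1 x) (h2 y) (h3 z)
     (has_meanB (has_mean_unit P uX) (has_mean_cst P (h1 x)))
     (has_meanB (has_mean_unit P uY) (has_mean_cst P (h2 y)))
     (has_meanB (has_mean_unit P uZ) (has_mean_cst P (h3 z)))))
   (has_mean_quad6 (h1 x) (h2 y) (h3 z)
     (has_meanZ (d1 x ^+ 2 * tau ^+ 2) EX2) (has_meanZ (d2 y ^+ 2 * tau ^+ 2) EY2)
     (has_meanZ (d3 z ^+ 2 * tau ^+ 2) EZ2)
     (has_meanZ (d1 x * d2 y * tau ^+ 2) EXY) (has_meanZ (d2 y * d3 z * tau ^+ 2) EYZ)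
     (has_meanZ (d1 x * d3 z * tau ^+ 2) EXZ)))
   (has_meanZ (K1 * tau ^+ 2) (mean_tail tau0)).
have LE := has_mean_le HL (has_mean_unit P uXYZ).
lapply LE => [{}LE|{LE} w]; last first.
  have [tX tY tZ] : [/\ `|tau * X w| <= tau * M w, `|tau * Y w| <= tau * M w &
      `|tau * Z w| <= tau * M w].
    have := (normr_ge0 (X w), normr_ge0 (Y w), normr_ge0 (Z w)) => -[[? ?] ?].
    by rewrite !normrM (ger0_norm tau0) !ler_wpM2l// /M; lra.
  apply: le_trans (low _ _ _ (d1 x) (d2 y) (d3 z) _ _ _ (tau * X w) (tau * Y w)
    (tau * Z w) (tau * M w) (u1.2 x) (u2.2 y) (u3.2 z) (uX.2 w) (uY.2 w) (uZ.2 w)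
    (dC1 _) (dC2 _) (dC3 _) (dh1 _ _) (dh2 _ _) (dh3 _ _) tX tY tZ).
  rewrite -subr_ge0 [leRHS](_ : _ = 0)// /quad6 /tail; ring.
have U := upp _ _ _ _ _ _ (u1.2 x) (u2.2 y) (u3.2 z) (unit_mean P uX)
  (unit_mean P uY) (unit_mean P uZ).
(* The covariances of the increments are those of X, Y, Z scaled by the slopes times tau, which is
   the form that [quad6_ge0] controls. *)
have Q := quad6_ge0 (h1 x) (h2 y) (h3 z) (d1 x * tau) (d2 y * tau) (d3 z * tau).
have err : K2 * (`|\int[P]_w h1 (x + tau * X w) - h1 x| +
    `|\int[P]_w h2 (y + tau * Y w) - h2 y| +
    `|\int[P]_w h3 (z + tau * Z w) - h3 z|) ^+ 2 <= 9 * K2 * C ^+ 2 * tau ^+ 4.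
  rewrite [leRHS](_ : _ = K2 * (3 * (C * tau ^+ 2)) ^+ 2); last by ring.
  rewrite ler_wpM2l// lerXn2r ?nnegrE ?addr_ge0 ?mulr_ge0 ?sqr_ge0//.
  by move: s1 s2 s3; lra.
have tail0 : 0 <= \int[P]_w tail tau w.
  apply: Rintegral_ge0 => w _; rewrite mulr_ge0 ?sqr_ge0//.
  by rewrite le_min ler01 mulr_ge0.
have e1 : 0 <= K1 * tau ^+ 4 by rewrite mulr_ge0 ?exprn_ge0.
have e2 : 0 <= 9 * K2 * C ^+ 2 * (tau ^+ 2 * \int[P]_w tail tau w).
  by rewrite !mulr_ge0 ?sqr_ge0.
apply: (le_trans U).
have {}Q : 0 <= quad6 (h1 x) (h2 y) (h3 z) (d1 x ^+ 2 * tau ^+ 2 * 1)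
   (d2 y ^+ 2 * tau ^+ 2 * 1) (d3 z ^+ 2 * tau ^+ 2 * 1)
   (d1 x * d2 y * tau ^+ 2 * - (1 / 3)) (d2 y * d3 z * tau ^+ 2 * - (1 / 3))
   (d1 x * d3 z * tau ^+ 2 * - (1 / 3)).
  apply: (le_trans Q); rewrite -subr_ge0 [leRHS](_ : _ = 0)// /quad6; ring.
move: LE err e1 e2 Q.
set q := quad6 _ _ _ _ _ _ _ _ _; set l := lin6 _ _ _ _ _ _.
set I := \int[P]_w tail tau w; set J := \int[P]_w (_ * _).
move=> *; lra.
Qed.

End OneDim.

(** Equality in law of (N + N')/sqrt 2 and N. Integrating separately over [w'] and [w] makes the two
    copies independent without introducing a product space. *)
Definition stable3 (d : measure_display) (T : measurableType d) (R : realType)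
    (P : probability T R) (X Y Z : T -> R) : Prop :=
  forall F : R * R * R -> R, unit_fun F ->
  \int[P]_w' (\int[P]_w F ((X w' + X w) / Num.sqrt 2, (Y w' + Y w) / Num.sqrt 2,
                           (Z w' + Z w) / Num.sqrt 2)) =
  \int[P]_w F (X w, Y w, Z w).

Section Doubling.
Context d (T : measurableType d) (R : realType) (P : probability T R).
Variables X Y Z : T -> R.
Hypotheses (mX : measurable_fun setT X) (mY : measurable_fun setT Y)
  (mZ : measurable_fun setT Z).
Hypothesis stabXYZ : stable3 P X Y Z.

Lemma measurable_affine2 (V : T -> R) x tau : measurable_fun setT V ->
  measurable_fun setT (fun z : T * T => x + tau * V z.1 + tau * V z.2).
Proof.
move=> mV; apply: measurable_funD; first apply: measurable_funD => //.
  by apply: measurable_funM => //; exact: measurableT_comp.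
by apply: measurable_funM => //; exact: measurableT_comp.
Qed.

(** The average of [d'] serves as slope, and the bounds pass under the integral unchanged, so the
    constant [C] does not grow along the doublings. *)
Lemma c11_mean C h (V : T -> R) tau : c11 C h -> measurable_fun setT V ->
  c11 C (fun x => \int[P]_w h (x + tau * V w)).
Proof.
move=> [uh [d' [md dC dh]]] mV.
have maff : measurable_fun setT (fun z : R * T => z.1 + tau * V z.2).
  apply: measurable_funD => //.
  by apply: measurable_funM => //; exact: measurableT_comp.
split.
  by apply: (@unit_mean2 _ _ _ T R P (fun z : R * T => h (z.1 + tau * V z.2)));
    exact: (unit_comp uh).
have dV x : has_mean P (fun w => d' (x + tau * V w)) (\int[P]_w d' (x + tau * V w)).
  apply: (has_mean_dom _ (has_mean_cst P C)) => //.
  by apply: measurableT_comp => //; exact: measurable_affine.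
have hV x : has_mean P (fun w => h (x + tau * V w)) (\int[P]_w h (x + tau * V w)).
  by apply: has_mean_unit; apply: (unit_comp uh); exact: measurable_affine.
exists (fun x => \int[P]_w d' (x + tau * V w)); split.
- apply: (@measurable_mean2 _ _ _ T R P (fun z : R * T => d' (z.1 + tau * V z.2)) C) => //.
  exact: measurableT_comp.
- move=> x; rewrite ler_norml; apply/andP; split.
    apply: (has_mean_le (has_mean_cst P (- C)) (dV x)) => w.
    by have := dC (x + tau * V w); rewrite ler_norml => /andP[].
  apply: (has_mean_le (dV x) (has_mean_cst P C)) => w.
  by have := dC (x + tau * V w); rewrite ler_norml => /andP[].
- move=> x t.
  have H := has_meanB (has_meanB (hV (x + t)) (hV x)) (has_meanZ t (dV x)).
  rewrite [X in _ - X]mulrC ler_norml; apply/andP; split.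
    apply: (has_mean_le (has_mean_cst P (- (C * t ^+ 2))) H) => w.
    have := dh (x + tau * V w) t; rewrite ler_norml => /andP[+ _].
    by rewrite (addrAC x) (mulrC t).
  apply: (has_mean_le H (has_mean_cst P (C * t ^+ 2))) => w.
  have := dh (x + tau * V w) t; rewrite ler_norml => /andP[_ +].
  by rewrite (addrAC x) (mulrC t).
Qed.

(* Since [P_tau P_tau = P_(sqrt 2 tau)] by stability, two applications at scale
   [tau], to [h_i] and to [P_tau h_i], give one at scale [sqrt 2 tau]. *)
Lemma rev_holder_double C tau e : rev_holder P X Y Z C tau e ->
  rev_holder P X Y Z C (Num.sqrt 2 * tau) (2 * e).
Proof.
move=> RH h1 h2 h3 c1 c2 c3 x y z.
have s2 : Num.sqrt 2 != 0 :> R by rewrite sqrtr_eq0 -ltNge.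
have half a b c : c + Num.sqrt 2 * tau * ((a + b) / Num.sqrt 2) =
    c + tau * a + tau * b by field.
have [u1 u2 u3] : [/\ unit_fun h1, unit_fun h2 & unit_fun h3].
  by split; [case: c1|case: c2|case: c3].
have m3 (f : R -> R) (pr : R * R * R -> R) (c : R) : unit_fun f ->
    measurable_fun setT pr ->
    unit_fun (fun p : R * R * R => f (c + Num.sqrt 2 * tau * pr p)).
  move=> uf mpr; apply: (unit_comp uf); apply: measurable_funD => //.
  exact: measurable_funM.
have p1 : measurable_fun setT (fun p : R * R * R => p.1.1).
  exact: (measurableT_comp measurable_fst measurable_fst).
have p2 : measurable_fun setT (fun p : R * R * R => p.1.2).
  exact: (measurableT_comp measurable_snd measurable_fst).
have p3 : measurable_fun setT (fun p : R * R * R => p.2) by exact: measurable_snd.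
have st1 := stabXYZ (m3 _ _ x u1 p1).
have st2 := stabXYZ (m3 _ _ y u2 p2).
have st3 := stabXYZ (m3 _ _ z u3 p3).
have st := stabXYZ (unitM (unitM (unitX 6 (m3 _ _ x u1 p1)) (unitX 6 (m3 _ _ y u2 p2)))
  (unitX 6 (m3 _ _ z u3 p3))).
rewrite /= in st1 st2 st3 st.
rewrite -st1 -st2 -st3 -st.
under eq_Rintegral do under eq_Rintegral do rewrite half.
under [X in _ * X ^+ 6 * _]eq_Rintegral do under eq_Rintegral do rewrite half.
under [X in _ * _ * X ^+ 6]eq_Rintegral do under eq_Rintegral do rewrite half.
under [X in _ <= X + _]eq_Rintegral do under eq_Rintegral do rewrite !half.
have g1 := c11_mean tau c1 mX; have g2 := c11_mean tau c2 mY.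
have g3 := c11_mean tau c3 mZ.
apply: (le_trans (RH _ _ _ g1 g2 g3 x y z)).
(* One [e] comes from the application to the averaged functions, the other from the application to
   [h1], [h2], [h3] at the shifted base points, integrated over [w]. *)
rewrite [2 * e](_ : _ = e + e); last by ring.
rewrite addrA lerD2r.
have maff V c : measurable_fun setT V -> measurable_fun setT (fun w : T => c + tau * V w).
  by move=> mV; exact: measurable_affine.
have ug V h c : measurable_fun setT V -> c11 C h ->
    unit_fun (fun w' => \int[P]_w h (c + tau * V w' + tau * V w)).
  move=> mV ch; have [ug _] := c11_mean tau ch mV.
  exact: (unit_comp ug (maff _ c mV)).
have uin := unitM (unitM (unitX 6 (ug _ _ x mX c1)) (unitX 6 (ug _ _ y mY c2)))
  (unitX 6 (ug _ _ z mZ c3)).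
have uout : unit_fun (fun p : T * T => h1 (x + tau * X p.1 + tau * X p.2) ^+ 6 *
    h2 (y + tau * Y p.1 + tau * Y p.2) ^+ 6 * h3 (z + tau * Z p.1 + tau * Z p.2) ^+ 6).
  by apply: unitM; [apply: unitM|]; apply: unitX;
    [apply: (unit_comp u1)|apply: (unit_comp u2)|apply: (unit_comp u3)];
    exact: measurable_affine2.
apply: (has_mean_le (has_mean_unit P uin)
  (has_meanD (has_mean_unit P (unit_mean2 P uout)) (has_mean_cst P e))) => w.
exact: RH.
Qed.

Lemma rev_holder_doubles C tau e r : rev_holder P X Y Z C tau e ->
  rev_holder P X Y Z C (Num.sqrt 2 ^+ r * tau) (2 ^+ r * e).
Proof.
elim: r => [|r IH] RH; first by rewrite !expr0 !mul1r.
by rewrite !exprS -!mulrA; exact/rev_holder_double/IH.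
Qed.

End Doubling.

Section Exact.
Context d (T : measurableType d) (R : realType) (P : probability T R).
Variables X Y Z : T -> R.
Hypotheses (mX : measurable_fun setT X) (mY : measurable_fun setT Y)
  (mZ : measurable_fun setT Z).
Local Notation has_mean := (has_mean P).
Hypotheses (EX : has_mean X 0) (EY : has_mean Y 0) (EZ : has_mean Z 0).
Hypotheses (EX2 : has_mean (fun w => X w ^+ 2) 1)
  (EY2 : has_mean (fun w => Y w ^+ 2) 1) (EZ2 : has_mean (fun w => Z w ^+ 2) 1).
Hypotheses (EXY : has_mean (fun w => X w * Y w) (- (1 / 3)))
  (EYZ : has_mean (fun w => Y w * Z w) (- (1 / 3)))
  (EXZ : has_mean (fun w => X w * Z w) (- (1 / 3))).
Hypothesis stabXYZ : stable3 P X Y Z.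

Lemma mean_tail_cvg0 (tau : R^nat) : (forall n, 0 <= tau n) ->
  tau @ \oo --> 0 -> \int[P]_w tail X Y Z (tau n) w @[n --> \oo] --> 0.
Proof.
move=> tau0 tauto0.
rewrite -[X in _ --> X](mean_cst P).
apply: (@mean_dominated_cvg _ _ _ P _ _
    (fun w => 3 * (X w ^+ 2 + Y w ^+ 2 + Z w ^+ 2))).
- by move=> n; exact: measurable_tail.
- by case: (has_meanZ 3 (has_meanD (has_meanD EX2 EY2) EZ2)).
- move=> n w; exact: le_trans (tail_le _ _ _ _ (tau0 n)) (sqr_norms_le _ _ _).
- move=> w; rewrite /tail; set M := _ + `|Z w|.
  have M0 : 0 <= M by rewrite !addr_ge0.
  apply: (@squeeze_cvgr _ _ _ _ (cst 0) (fun n => M ^+ 2 * (tau n * M))).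
  + apply: nearW => n /=; rewrite mulr_ge0 ?sqr_ge0 ?le_min ?ler01 ?mulr_ge0//=.
    by rewrite ler_wpM2l ?sqr_ge0// ge_min lexx orbT.
  + exact: cvg_cst.
  + rewrite -[X in _ --> X](mulr0 (M ^+ 2)); apply: cvgMl_tmp.
    by rewrite -[X in _ --> X](mul0r M); exact: cvgMr_tmp.
Qed.

Lemma rev_holder1 C : 0 <= C -> rev_holder P X Y Z C 1 0.
Proof.
move=> C0.
have [K K0 loc] := rev_holder_local mX mY mZ EX EY EZ EX2 EY2 EZ2 EXY EYZ EXZ C0.
pose tau r : R := (Num.sqrt 2)^-1 ^+ r.
have s0 : 0 < Num.sqrt 2 :> R by rewrite sqrtr_gt0.
have s2 : Num.sqrt 2 ^+ 2 = 2 :> R by rewrite sqr_sqrtr.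
have tau_ge0 r : 0 <= tau r by rewrite exprn_ge0// invr_ge0 ltW.
have tau_to0 : tau @ \oo --> 0.
  apply: cvg_expr; rewrite ger0_norm ?invr_ge0 ?(ltW s0)// invf_lt1//.
  by rewrite -[X in X < _]sqrtr1 ltr_sqrt// ltr1n.
have tail_to0 := mean_tail_cvg0 tau_ge0 tau_to0.
move=> h1 h2 h3 c1 c2 c3 x y z; rewrite addr0.
set A := (X in X <= _); set B := (X in _ <= X).
(* After r doublings the scale is exactly 1. Since 2^r tau^2 = 1, the error 2^r K (tau^2 I + tau^4)
   becomes K (I + tau^2), and I, the mean of the tail, tends to 0. *)
have bound r : A <= B + K * (\int[P]_w tail X Y Z (tau r) w + tau r * tau r).
  have RH := rev_holder_doubles mX mY mZ stabXYZ r (loc _ (tau_ge0 r)).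
  have taus : Num.sqrt 2 ^+ r * tau r = 1.
    by rewrite /tau exprVn mulfV// expf_neq0// gt_eqF.
  have tau2 : 2 ^+ r * tau r ^+ 2 = 1.
    by rewrite -s2 -exprM mulnC exprM -exprMn taus expr1n.
  rewrite taus in RH; apply: (le_trans (RH _ _ _ c1 c2 c3 x y z)).
  rewrite lerD2l le_eqVlt; apply/orP; left; apply/eqP.
  set I := \int[P]_w _.
  rewrite [LHS](_ : _ = K * ((2 ^+ r * tau r ^+ 2) * I
    + (2 ^+ r * tau r ^+ 2) * (tau r * tau r))); last by ring.
  by rewrite tau2 !mul1r.
have lim : B + K * (\int[P]_w tail X Y Z (tau r) w + tau r * tau r) @[r --> \oo]
    --> B + K * (0 + 0 * 0).
  apply: cvgD; first exact: cvg_cst.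
  by apply: cvgMl_tmp; apply: cvgD => //; exact: cvgM.
rewrite mul0r addr0 mulr0 addr0 in lim.
by apply: (cvgr_to_ge lim); apply: nearW.
Qed.

End Exact.

(** * Approximation by smooth functions *)

Section C11.
Variable R : realType.
Implicit Types (C : R) (g h : R -> R).

Lemma c11_le C C' h : C <= C' -> c11 C h -> c11 C' h.
Proof.
move=> CC [uh [d [md dC dh]]]; split => //; exists d; split => // [x|x t].
  exact: le_trans (dC x) CC.
by apply: (le_trans (dh x t)); rewrite ler_wpM2r ?sqr_ge0.
Qed.

Lemma c11_0 : c11 0 (fun=> 0 : R).
Proof.
split; first by split => // x; rewrite lexx ler01.
by exists (fun=> 0); split => // [x|x t]; rewrite ?subrr ?mul0r ?subrr normr0.
Qed.

Lemma c11_onem C h : c11 C h -> c11 C (fun x => 1 - h x).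
Proof.
move=> [uh [d [md dC dh]]]; split; first exact: unit_onem.
exists (fun x => - d x); split => [|x|x t].
- exact: measurable_funN.
- by rewrite normrN.
- rewrite -normrN; rewrite [X in `|X|](_ : _ = h (x + t) - h x - d x * t) //.
  by ring.
Qed.

Lemma c11_half C h g : c11 C h -> c11 C g -> c11 C (fun x => (h x + g x) / 2).
Proof.
move=> [[mh h01] [d [md dC dh]]] [[mg g01] [e [me eC eg]]]; split.
  split; first by apply: measurable_funM => //; exact: measurable_funD.
  by move=> x; have /andP[? ?] := h01 x; have /andP[? ?] := g01 x; lra.
exists (fun x => (d x + e x) / 2); split => [|x|x t].
- by apply: measurable_funM => //; exact: measurable_funD.
- by have := dC x; have := eC x; rewrite !ler_norml; lra.
- by have := dh x t; have := eg x t; rewrite !ler_norml; lra.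
Qed.

(** For |t| <= 1 the quadratic term is at most C |t|; for |t| > 1 the values in [0, 1] differ by at
    most 1. *)
Lemma c11_lipschitz C h x t : 0 <= C -> c11 C h ->
  `|h (x + t) - h x| <= (2 * C + 1) * `|t|.
Proof.
move=> C0 [[mh h01] [d [md dC dh]]].
have [t1|t1] := leP `|t| 1.
  have dt : `|d x * t| <= C * `|t| by rewrite normrM ler_wpM2r.
  have t2 : C * t ^+ 2 <= C * `|t|.
    by rewrite ler_wpM2l// -real_normK ?num_real// expr2 ler_piMr.
  have := dh x t; have := normr_ge0 t; move: dt.
  set D := d x * t; set u := `|t| in t1 t2 *.
  by rewrite !ler_norml => /andP[? ?] ? /andP[? ?]; apply/andP; split; lra.
have /andP[? ?] := h01 x; have /andP[? ?] := h01 (x + t).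
apply: (@le_trans _ _ 1); first by rewrite ler_norml; lra.
have Ct : 0 <= C * `|t| by rewrite mulr_ge0.
lra.
Qed.

(** The remainder of the product consists of one remainder per factor, C t^2 each, and the product
    of the two increments, which [c11_lipschitz] bounds by (2 C + 1)^2 t^2. *)
Lemma c11M C h g : 0 <= C -> c11 C h -> c11 C g ->
  c11 (2 * C + (2 * C + 1) ^+ 2) (fun x => h x * g x).
Proof.
move=> C0 ch cg; have Lh := c11_lipschitz _ _ C0 ch.
have Lg := c11_lipschitz _ _ C0 cg.
have [[mh h01] [d [md dC dh]]] := ch; have [[mg g01] [e [me eC eg]]] := cg.
split; first by apply: unitM; [exact: ch.1|exact: cg.1].
have n1 f : (forall x, 0 <= f x <= 1) -> forall x : R, `|f x| <= 1 :> R.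
  by move=> f01 x; have /andP[? ?] := f01 x; rewrite ger0_norm.
exists (fun x => h x * e x + d x * g x); split => [|x|x t].
- by apply: measurable_funD; exact: measurable_funM.
- have a1 := ler_normM (n1 _ h01 x) (eC x); have a2 := ler_normM (dC x) (n1 _ g01 x).
  have := ler_normD (h x * e x) (d x * g x).
  by have := sqr_ge0 (2 * C + 1); lra.
- have -> : h (x + t) * g (x + t) - h x * g x - (h x * e x + d x * g x) * t =
    h x * (g (x + t) - g x - e x * t) + (h (x + t) - h x - d x * t) * g x
    + (h (x + t) - h x) * (g (x + t) - g x) by ring.
  have a1 := ler_normM (n1 _ h01 x) (eg x t).
  have a2 := ler_normM (dh x t) (n1 _ g01 x).
  have a3 := ler_normM (Lh x t) (Lg x t).
  rewrite mulrACA -!expr2 real_normK ?num_real// in a3.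
  move: a1 a2 a3; set u := _ * (_ - _ - _); set v := (_ - _ - _) * _.
  set w := (_ - _) * _ => a1 a2 a3.
  by have := ler_normD (u + v) w; have := ler_normD u v; lra.
Qed.

Lemma c11_affine C h l b : 0 <= C -> c11 C h ->
  c11 (C * `|l| + C * l ^+ 2) (fun x => h (l * x + b)).
Proof.
move=> C0 [uh [d [md dC dh]]].
have maff : measurable_fun setT (fun x : R => l * x + b).
  by apply: measurable_funD => //; exact: measurable_funM.
split; first exact: (unit_comp uh).
exists (fun x => d (l * x + b) * l); split => [|x|x t].
- by apply: measurable_funM => //; exact: measurableT_comp.
- have := ler_normM (dC (l * x + b)) (lexx `|l|).
  by have := mulr_ge0 C0 (sqr_ge0 l); lra.
- have := dh (l * x + b) (l * t).
  rewrite [l * x + b + l * t](_ : _ = l * (x + t) + b); last by ring.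
  rewrite mulrA => /le_trans; apply.
  by rewrite exprMn mulrA ler_wpM2r ?sqr_ge0// lerDr mulr_ge0.
Qed.

(** It vanishes for x <= 0 and tends to 1 at infinity, so its dilations converge to the indicator of
    x > 0. The square removes the corner at 0, and a rational formula reduces the estimates to
    algebra. *)
Definition ramp (x : R) : R := 1 - (1 + (Num.max x 0) ^+ 2)^-1.

Lemma c11_ramp : c11 4 ramp.
Proof.
pose A (m : R) := (1 + m ^+ 2)^-1.
have den m : 0 < 1 + m ^+ 2 :> R by rewrite ltr_pwDl// sqr_ge0.
have A0 m : 0 < A m by rewrite invr_gt0.
have A1 m : A m <= 1 by rewrite invf_le1// lerDl sqr_ge0.
have AE m : A m * (1 + m ^+ 2) = 1 by rewrite mulVf// gt_eqF.
have mA2 m : 2 * m * A m <= 1.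
  rewrite -[leRHS](AE m) mulrC ler_wpM2l ?(ltW (A0 m))//.
  by rewrite -subr_ge0 [leRHS](_ : _ = (1 - m) ^+ 2) ?sqr_ge0//; ring.
have mm : measurable_fun setT (fun x : R => Num.max x 0) by exact: measurable_maxr.
have mA : measurable_fun setT A.
  apply: continuous_measurable_fun => m; apply: cvgV; first by rewrite gt_eqF.
  by apply: cvgD; [exact: cvg_cst|exact: exprn_continuous].
have mAm : measurable_fun setT (fun x : R => A (Num.max x 0)).
  exact: measurableT_comp.
split.
  split; first exact: measurable_funB.
  move=> x; have := A0 (Num.max x 0); have := A1 (Num.max x 0).
  by rewrite /ramp -/(A _); lra.
exists (fun x => 2 * Num.max x 0 * A (Num.max x 0) ^+ 2); split => [|x|x t].
- by apply: measurable_funM; [exact: measurable_funM|exact: measurable_funX].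
- set m := Num.max x 0; have m0 : 0 <= m by rewrite le_max lexx orbT.
  have p0 : 0 <= 2 * m * A m by rewrite !mulr_ge0// ltW.
  rewrite expr2 mulrA ger0_norm; last by rewrite mulr_ge0// ltW.
  have : 2 * m * A m * A m <= 1 by rewrite mulr_ile1// ltW.
  lra.
- rewrite /ramp -!/(A _).
  set m := Num.max x 0; set m' := Num.max (x + t) 0.
  have m0 : 0 <= m by rewrite le_max lexx orbT.
  have m'0 : 0 <= m' by rewrite le_max lexx orbT.
  pose dl := m' - m.
  have m'E : m' = m + dl by rewrite /dl; ring.
  have dl2 : dl ^+ 2 <= t ^+ 2.
    rewrite -(real_normK (num_real dl)) -(real_normK (num_real t)).
    rewrite lerXn2r ?nnegrE//.
    by rewrite /dl /m /m'; case: (leP x 0) => ?; case: (leP (x + t) 0) => ?; rewrite ler_norml;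
      have := ler_norm t; have := ler_norm (- t); rewrite normrN; lra.
  (* The product vanishes unless x > 0 >= x + t; in that case both m and dl - t lie between 0 and
     |t|. *)
  have mt : 0 <= m * (dl - t) <= t ^+ 2.
    rewrite /dl /m /m'; case: (leP x 0) => ?; case: (leP (x + t) 0) => ?; apply/andP; split; nra.
  have ABE : A m - A m' = A m * A m' * (dl * (m + m')).
    rewrite -[LHS](_ : A m * (A m' * (1 + m' ^+ 2)) - A m' * (A m * (1 + m ^+ 2)) = _).
      by rewrite m'E; ring.
    by rewrite !AE !mulr1.
  (* The two sides differ by a multiple of the identity [ABE]. On the right, each summand is a
     factor in [0, 1] times dl^2 or 2 m (dl - t), hence of size at most t^2, t^2 and 2 t^2, whence
     the constant 4. *)
  have split3 : 1 - A m' - (1 - A m) - 2 * m * A m ^+ 2 * t =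
      A m * A m' * dl ^+ 2
      - 2 * m * A m * (A m * (A m' * (m + m'))) * dl ^+ 2
      + 2 * A m ^+ 2 * (m * (dl - t)).
    apply/subr0_eq.
    rewrite [LHS](_ : _ = (A m - A m' - A m * A m' * (dl * (m + m')))
      * (1 - 2 * m * A m * dl)); last by rewrite m'E; ring.
    by rewrite ABE subrr mul0r.
  rewrite split3.
  have [a0 a1] := (ltW (A0 m), A1 m); have [b0 b1] := (ltW (A0 m'), A1 m').
  have ab : 0 <= A m * A m' <= 1 by rewrite mulr_ge0//= mulr_ile1.
  have k1 : 0 <= 2 * m * A m <= 1 by rewrite mA2 !mulr_ge0.
  have k1' : 0 <= 2 * m' * A m' <= 1 by rewrite mA2 !mulr_ge0.
  have k2 : 0 <= A m * (A m' * (m + m')) <= 1.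
    have /andP[p0 p1] := k1; have /andP[q0 q1] := k1'.
    have r1 := mulr_ile1 p0 b0 p1 b1; have r2 := mulr_ile1 q0 a0 q1 a1.
    rewrite !mulr_ge0 ?addr_ge0//=.
    rewrite [leLHS](_ : _ = (2 * m * A m * A m' + 2 * m' * A m' * A m) / 2); last by field.
    lra.
  have k12 : 0 <= 2 * m * A m * (A m * (A m' * (m + m'))) <= 1.
    by have /andP[? ?] := k1; have /andP[? ?] := k2; rewrite mulr_ge0//= mulr_ile1.
  have a2 : 0 <= A m ^+ 2 <= 1 by rewrite exprn_ge0//= exprn_ile1.
  have sq : 0 <= dl ^+ 2 by exact: sqr_ge0.
  have sand (u v w : R) : 0 <= u <= 1 -> 0 <= v <= w -> 0 <= u * v <= w.
    move=> /andP[? ?] /andP[? ?]; rewrite mulr_ge0//=.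
    by apply: (@le_trans _ _ v) => //; rewrite ler_piMl.
  have d2 : 0 <= dl ^+ 2 <= t ^+ 2 by rewrite sq.
  have /andP[? ?] := sand _ _ _ ab d2.
  have /andP[? ?] := sand _ _ _ k12 d2.
  have /andP[? ?] := sand _ _ _ a2 mt.
  by rewrite ler_norml; apply/andP; split; lra.
Qed.

Lemma ramp_cvg x : ramp (n.+1%:R * x) @[n --> \oo] --> (\1_`]0, +oo[ x : R).
Proof.
rewrite indicE; have [x0|x0] := leP x 0.
  rewrite memNset; last by rewrite /= in_itv/= andbT; apply/negP; rewrite -leNgt.
  rewrite (_ : (fun _ => _) = (fun=> 0)); first exact: cvg_cst.
  apply/funext => n; rewrite /ramp max_r ?mulr_ge0_le0//.
  by rewrite expr0n/= addr0 invr1 subrr.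
rewrite mem_set ?/= ?in_itv/= ?andbT//.
apply: (@squeeze_cvgr _ _ _ _ (fun n => 1 - x ^- 2 * n.+1%:R^-1) (cst 1)).
- apply: nearW => n /=; rewrite /ramp max_l ?mulr_ge0 ?(ltW x0)//.
  have nx : 0 < (n.+1%:R * x) ^+ 2 by rewrite exprn_gt0// mulr_gt0.
  apply/andP; split; last by rewrite gerBl invr_ge0 addr_ge0// (ltW nx).
  rewrite lerB// -invfM lef_pV2 ?posrE ?addr_gt0 ?mulr_gt0 ?exprn_gt0//.
  rewrite exprMn mulrC; apply: (@le_trans _ _ (n.+1%:R ^+ 2 * x ^+ 2)); last lra.
  by rewrite ler_wpM2r ?sqr_ge0// -natrX ler_nat leq_pmulr.
- rewrite -[X in _ --> X]subr0 -(mulr0 (x ^- 2)).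
  apply: cvgB; first exact: cvg_cst.
  by apply: cvgMl_tmp; exact: cvg_harmonic.
- exact: cvg_cst.
Qed.

End C11.

Section Approximation.
Context d (T : measurableType d) (R : realType) (P : probability T R).
Variable V : T -> R.
Hypothesis mV : measurable_fun setT V.
Implicit Types f g h : R -> R.

(** Approximation in L^1 of the law of [V]. The constant [C] may blow up as [e] tends to 0, which is
    harmless: at scale 1 the inequality has error 0 for every [C]. *)
Definition c11_approx h : Prop := forall e, 0 < e -> exists2 g : R -> R,
  (exists2 C, 0 <= C & c11 C g) & \int[P]_w `|h (V w) - g (V w)| <= e.

Let dist_mean f g : unit_fun f -> unit_fun g ->
  has_mean P (fun w => `|f (V w) - g (V w)|) (\int[P]_w `|f (V w) - g (V w)|).
Proof.
move=> [mf f01] [mg g01]; apply: (has_mean_dom _ (has_mean_cst P 1)).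
  by apply: measurableT_comp => //; apply: measurable_funB; exact: measurableT_comp.
move=> w; have /andP[? ?] := f01 (V w); have /andP[? ?] := g01 (V w).
by rewrite normr_id ler_norml; lra.
Qed.

Lemma c11_approx_of C h : 0 <= C -> c11 C h -> c11_approx h.
Proof.
move=> C0 ch e e0; exists h; first by exists C.
under eq_Rintegral do rewrite subrr normr0.
by rewrite mean_cst ltW.
Qed.

Lemma c11_approx_onem h : unit_fun h -> c11_approx h ->
  c11_approx (fun x => 1 - h x).
Proof.
move=> uh ah e e0; have [g [C C0 cg] hg] := ah e e0.
exists (fun x => 1 - g x); first by exists C => //; exact: c11_onem.
apply: le_trans hg; rewrite le_eqVlt; apply/orP; left; apply/eqP.
apply: eq_Rintegral => w _; rewrite -normrN; congr `|_|; ring.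
Qed.

Let approx2 (op : R -> R -> R) :
  (forall x y x' y', 0 <= x <= 1 -> 0 <= y <= 1 -> 0 <= x' <= 1 -> 0 <= y' <= 1 ->
    `|op x y - op x' y'| <= `|x - x'| + `|y - y'|) ->
  (forall f g, unit_fun f -> unit_fun g -> unit_fun (fun x => op (f x) (g x))) ->
  (forall C f g, 0 <= C -> c11 C f -> c11 C g ->
    exists2 C', 0 <= C' & c11 C' (fun x => op (f x) (g x))) ->
  forall f g, unit_fun f -> unit_fun g -> c11_approx f -> c11_approx g ->
  c11_approx (fun x => op (f x) (g x)).
Proof.
move=> opl opu opc f g uf ug af ag e e0.
have e20 : 0 < e / 2 by rewrite divr_gt0.
have [f' [C C0 cf'] ff'] := af _ e20; have [g' [C' C'0 cg'] gg'] := ag _ e20.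
have CC0 : 0 <= C + C' by rewrite addr_ge0.
have C1 : C <= C + C' by rewrite lerDl.
have C2 : C' <= C + C' by rewrite lerDr.
have [D D0 cD] := opc _ _ _ CC0 (c11_le C1 cf') (c11_le C2 cg').
have [uf' ug'] := (cf'.1, cg'.1).
exists (fun x => op (f' x) (g' x)); first by exists D.
apply: (@le_trans _ _ (e / 2 + e / 2)); last lra.
apply: le_trans (lerD ff' gg').
apply: (has_mean_le (dist_mean (opu _ _ uf ug) (opu _ _ uf' ug'))
  (has_meanD (dist_mean uf uf') (dist_mean ug ug'))) => w.
by apply: opl; [exact: uf.2|exact: ug.2|exact: uf'.2|exact: ug'.2].
Qed.

Lemma c11_approxM f g : unit_fun f -> unit_fun g ->
  c11_approx f -> c11_approx g -> c11_approx (fun x => f x * g x).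
Proof.
apply: approx2 => [x y x' y' x01 y01 x'01 y'01|f' g'|C f' g' C0 cf cg].
- have -> : x * y - x' * y' = (x - x') * y + x' * (y - y') by ring.
  apply: (le_trans (ler_normD _ _)); rewrite !normrM; apply: lerD.
    by have /andP[? ?] := y01; rewrite ler_piMr// ger0_norm.
  by have /andP[? ?] := x'01; rewrite ler_piMl// ger0_norm.
- exact: unitM.
- by exists (2 * C + (2 * C + 1) ^+ 2); [rewrite addr_ge0 ?sqr_ge0 ?mulr_ge0|exact: c11M].
Qed.

Lemma c11_approx_half f g : unit_fun f -> unit_fun g ->
  c11_approx f -> c11_approx g -> c11_approx (fun x => (f x + g x) / 2).
Proof.
apply: (approx2 (op := fun x y => (x + y) / 2))
  => [x y x' y' _ _ _ _|f' g' [mf f01] [mg g01]|C f' g' C0 cf cg].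
- have -> : (x + y) / 2 - (x' + y') / 2 = ((x - x') + (y - y')) / 2 by field.
  have := ler_normD (x - x') (y - y'); rewrite normrM (ger0_norm (x := 2^-1))//.
  by have := normr_ge0 (x - x'); have := normr_ge0 (y - y'); lra.
- split; first by apply: measurable_funM => //; exact: measurable_funD.
  by move=> x; have /andP[? ?] := f01 x; have /andP[? ?] := g01 x; lra.
- by exists C => //; exact: c11_half.
Qed.

Lemma c11_approx_dist f : unit_fun f ->
  (forall e, 0 < e -> exists g, [/\ unit_fun g, c11_approx g &
     \int[P]_w `|f (V w) - g (V w)| <= e]) -> c11_approx f.
Proof.
move=> uf ex e e0; have e20 : 0 < e / 2 by rewrite divr_gt0.
have [g [ug ag fg]] := ex _ e20; have [k [C C0 ck] gk] := ag _ e20.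
exists k; first by exists C.
apply: (@le_trans _ _ (e / 2 + e / 2)); last lra.
apply: le_trans (lerD fg gk).
apply: (has_mean_le (dist_mean uf ck.1)
  (has_meanD (dist_mean uf ug) (dist_mean ug ck.1))) => w.
exact: ler_distD.
Qed.

Lemma c11_approx_cvg (f_ : nat -> R -> R) f : unit_fun f ->
  (forall n, unit_fun (f_ n)) -> (forall n, c11_approx (f_ n)) ->
  (forall x, f_ ^~ x @ \oo --> f x) -> c11_approx f.
Proof.
move=> uf uf_ af_ f_f; apply: c11_approx_dist => // e e0.
have cvg0 : \int[P]_w `|f (V w) - f_ n (V w)| @[n --> \oo] --> 0.
  rewrite -[X in _ --> X](mean_cst P).
  apply: (@mean_dominated_cvg _ _ _ P _ _ (fun=> 1)).
  - move=> n; apply: measurableT_comp => //.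
    by apply: measurable_funB; apply: measurableT_comp => //; [case: uf|case: (uf_ n)].
  - exact: finite_measure_integrable_cst.
  - move=> n w; rewrite normr_id ler_norml.
    by have /andP[? ?] := uf.2 (V w); have /andP[? ?] := (uf_ n).2 (V w); lra.
  - move=> w; rewrite -(normr0 R) -(subrr (f (V w))); apply: cvg_norm.
    by apply: cvgB; [exact: cvg_cst|exact: f_f].
move/cvgr_le : cvg0 => /(_ _ e0)[n _ nle]; exists (f_ n); split => //.
exact: nle n (leqnn n).
Qed.

Lemma c11_approx_ray a : c11_approx (\1_`]a, +oo[).
Proof.
apply: (@c11_approx_cvg (fun n x => ramp (n.+1%:R * x + - (n.+1%:R * a)))).
- exact: unit_indic.
- by move=> n; have [] := c11_affine n.+1%:R (- (n.+1%:R * a)) (ler0n _ 4) (c11_ramp R).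
- move=> n; apply: c11_approx_of (c11_affine _ _ (ler0n _ 4) (c11_ramp R)).
  by rewrite addr_ge0// mulr_ge0// sqr_ge0.
- move=> x; have := @ramp_cvg R (x - a).
  rewrite !indicE [in X in X -> _](_ : (x - a \in _) = (x \in `]a, +oo[%classic)).
    apply: cvg_trans; apply: near_eq_cvg; apply: nearW => n.
    by congr ramp; ring.
  by rewrite !mem_setE !in_itv/= !andbT subr_gt0.
Qed.

(** Open rays form a pi-system that generates the Borel sets, and the sets with approximable
    indicator are closed under complements and countable disjoint unions. *)
Lemma c11_approx_indic (B : set R) : measurable B -> c11_approx (\1_B).
Proof.
pose G := [set A : set R | exists x, A = `]x, +oo[%classic].
have GE : @measurable _ R = <<s G >>.
  exact: RGenOInfty.measurableE.
move=> mB; have {mB} : <<s G >> B by rewrite -GE.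
apply: (@dynkin_induction _ R G (fun B => c11_approx \1_B)) => //.
- move=> _ _ [x ->] [y ->]; exists (Num.max x y).
  by apply/seteqP; split => z /=; rewrite !in_itv/= !andbT gt_max => /andP.
- rewrite (_ : \1_setT = fun x => 1 - 0); last first.
    by apply/funext => x; rewrite indicT subr0.
  apply: c11_approx_onem; first by have [] := c11_0 R.
  exact: c11_approx_of (c11_0 R).
- by move=> _ [x ->]; exact: c11_approx_ray.
- move=> S mS aS; rewrite (_ : \1_(~` S) = fun x => 1 - \1_S x).
    by apply: c11_approx_onem => //; exact: unit_indic.
  by apply/funext => x; rewrite !indicE in_setC; case: (x \in S) => /=; ring.
- move=> F mF tF aF.
  apply: (@c11_approx_cvg (fun n => \1_(\big[setU/set0]_(k < n) F k))).
  + by apply: unit_indic; exact: bigcup_measurable.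
  + by move=> n; apply: unit_indic; exact: bigsetU_measurable.
  + elim => [|n IH].
      by rewrite big_ord0 indic0; exact: c11_approx_of (c11_0 R).
    rewrite big_ord_recr/=; set A := \big[_/_]_(_ < _) _.
    have mA : measurable A by exact: bigsetU_measurable.
    (* De Morgan expresses the union by complements and a product, operations that preserve both
       values in [0, 1] and [c11_approx]. *)
    rewrite (_ : \1_(A `|` F n) = fun x => 1 - (1 - \1_A x) * (1 - \1_(F n) x)).
      have [uA uF] : unit_fun (\1_A : R -> R) /\ unit_fun (\1_(F n) : R -> R).
        by split; exact: unit_indic.
      apply: c11_approx_onem; first by apply: unitM; exact: unit_onem.
      by apply: c11_approxM; [exact: unit_onem|exact: unit_onem| |];
        exact: c11_approx_onem.
    apply/funext => x; rewrite !indicE in_setU.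
    by case: (x \in A); case: (x \in F n) => /=; ring.
  + move=> x; rewrite indicE; case: (boolP (x \in _)) => [|xF].
      rewrite inE => -[N _ FNx]; apply: cvg_near_cst.
      exists N.+1 => // n /= Nn; rewrite indicE mem_set//.
      by rewrite -bigcup_mkord; exists N.
    apply: cvg_near_cst; apply: nearW => n; rewrite indicE memNset//.
    move: xF; rewrite notin_setE => xF; apply: contra_not xF => xF.
    by move: xF; rewrite /= -bigcup_mkord => -[k _ Fk]; exists k.
Qed.

(* Peel off binary digits: [h = (1_{h > 1/2} + h') / 2] with [h'] in [[0, 1]]. *)
Lemma c11_approx_unit h : unit_fun h -> c11_approx h.
Proof.
have dyadic n : forall h, unit_fun h -> exists g, [/\ unit_fun g, c11_approx g &
    forall x, `|h x - g x| <= 2^-1 ^+ n].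
  elim: n => [h' uh|n IH h' uh].
    exists (fun=> 0); split; [by have [] := c11_0 R|exact: c11_approx_of (c11_0 R)|].
    by move=> x; have /andP[? ?] := uh.2 x; rewrite subr0 ger0_norm.
  pose B := h' @^-1` `]2^-1, +oo[.
  have mB : measurable B by rewrite -[B]setTI; exact: uh.1.
  have uB : unit_fun (\1_B : R -> R) by exact: unit_indic.
  have uk : unit_fun (fun x => 2 * h' x - \1_B x).
    split; first by apply: measurable_funB; [apply: measurable_funM => //; exact: uh.1|exact: uB.1].
    move=> x; have := uh.2 x; rewrite indicE.
    case: (boolP (x \in B)); rewrite ?notin_setE ?inE /B/= in_itv/= andbT => h2 /andP[? ?].
      lra.
    by move/negP: h2; rewrite -leNgt => ?; lra.
  have [g [ug ag gk]] := IH _ uk.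
  exists (fun x => (\1_B x + g x) / 2); split.
  - split; first by apply: measurable_funM => //; apply: measurable_funD; [exact: uB.1|exact: ug.1].
    by move=> x; have := uB.2 x; have := ug.2 x; lra.
  - by apply: c11_approx_half => //; exact: c11_approx_indic.
  - move=> x; rewrite (_ : h' x - _ = 2^-1 * (2 * h' x - \1_B x - g x)); last by field.
    by rewrite normrM (ger0_norm (x := 2^-1))// exprS ler_wpM2l.
move=> uh; apply: c11_approx_dist => // e e0.
have half0 : (2^-1 : R) ^+ n @[n --> \oo] --> 0.
  by apply: cvg_expr; rewrite ger0_norm// invf_lt1// ltr1n.
move/cvgr_le : half0 => /(_ _ e0)[n _ nle]; have {}nle := nle n (leqnn n).
have [g [ug ag gh]] := dyadic n h uh; exists g; split => //.
apply: le_trans nle.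
by apply: (has_mean_le (dist_mean uh ug) (has_mean_cst P _)) => w; exact: gh.
Qed.

End Approximation.

(** * Tensorization *)

Definition prod_bound (d dS : measure_display) (T : measurableType d)
    (S : measurableType dS) (R : realType) (P : probability T R)
    (U V W : T -> S) : Prop :=
  forall f g h : S -> R, unit_fun f -> unit_fun g -> unit_fun h ->
  (\int[P]_w f (U w)) ^+ 6 * (\int[P]_w g (V w)) ^+ 6 * (\int[P]_w h (W w)) ^+ 6
  <= \int[P]_w (f (U w) ^+ 6 * g (V w) ^+ 6 * h (W w) ^+ 6).

Lemma prod_bound_c11 (d : measure_display) (T : measurableType d) (R : realType)
    (P : probability T R) (X Y Z : T -> R) :
  measurable_fun setT X -> measurable_fun setT Y -> measurable_fun setT Z ->
  (forall C, 0 <= C -> rev_holder P X Y Z C 1 0) -> prod_bound P X Y Z.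
Proof.
move=> mX mY mZ RH f g h uf ug uh.
apply/ler_addgt0Pr => e e0.
(* 36 = 2 * 3 * 6: two sides of the inequality, three functions, and the Lipschitz constant 6 of
   [monom6_lip]. *)
have e'0 : 0 < e / 36 by rewrite divr_gt0.
have [f' [C1 C10 cf] ff] := c11_approx_unit P mX uf e'0.
have [g' [C2 C20 cg] gg] := c11_approx_unit P mY ug e'0.
have [h' [C3 C30 ch] hh] := c11_approx_unit P mZ uh e'0.
have C0 : 0 <= C1 + C2 + C3 by rewrite !addr_ge0.
have {}cf : c11 (C1 + C2 + C3) f' by apply: c11_le cf; lra.
have {}cg : c11 (C1 + C2 + C3) g' by apply: c11_le cg; lra.
have {}ch : c11 (C1 + C2 + C3) h' by apply: c11_le ch; lra.
have := RH _ C0 _ _ _ cf cg ch 0 0 0; rewrite addr0.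
have E (k : R -> R) (V : T -> R) w : k (0 + 1 * V w) = k (V w) by rewrite add0r mul1r.
under eq_Rintegral do rewrite E.
under [X in _ * X ^+ 6 * _]eq_Rintegral do rewrite E.
under [X in _ * X ^+ 6]eq_Rintegral do rewrite E.
under [X in _ <= X]eq_Rintegral do rewrite !E.
move=> RH'.
have uc k V : unit_fun k -> measurable_fun setT V -> unit_fun (fun w : T => k (V w) : R).
  by move=> uk mV; exact: (unit_comp uk).
have [ufX ugY uhZ] : [/\ unit_fun (fun w => f (X w)), unit_fun (fun w => g (Y w)) &
    unit_fun (fun w => h (Z w))] by split; exact: uc.
have [uf'X ug'Y uh'Z] : [/\ unit_fun (fun w => f' (X w)), unit_fun (fun w => g' (Y w)) &
    unit_fun (fun w => h' (Z w))].
  by split; apply: uc => //; [exact: cf.1|exact: cg.1|exact: ch.1].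
have dist k k' : unit_fun k -> unit_fun k' ->
    has_mean P (fun w => `|k w - k' w|) (\int[P]_w `|k w - k' w|).
  move=> [mk k01] [mk' k'01]; apply: (has_mean_dom _ (has_mean_cst P 1)).
    by apply: measurableT_comp => //; exact: measurable_funB.
  move=> w; have /andP[? ?] := k01 w; have /andP[? ?] := k'01 w.
  by rewrite normr_id ler_norml; lra.
have mean_dist k k' : unit_fun k -> unit_fun k' ->
    `|\int[P]_w k w - \int[P]_w k' w| <= \int[P]_w `|k w - k' w|.
  move=> uk uk'; have H := has_meanB (has_mean_unit P uk) (has_mean_unit P uk').
  have D := dist _ _ uk uk'.
  rewrite ler_norml; apply/andP; split.
    by apply: (has_mean_le (has_meanN D) H) => w; rewrite lerNl -normrN ler_norm.
  by apply: (has_mean_le H D) => w; exact: ler_norm.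
have A := monom6_lip (unit_mean P ufX) (unit_mean P ugY) (unit_mean P uhZ)
  (unit_mean P uf'X) (unit_mean P ug'Y) (unit_mean P uh'Z).
have a1 := mean_dist _ _ ufX uf'X; have a2 := mean_dist _ _ ugY ug'Y.
have a3 := mean_dist _ _ uhZ uh'Z.
have uI := unitM (unitM (unitX 6 ufX) (unitX 6 ugY)) (unitX 6 uhZ).
have uI' := unitM (unitM (unitX 6 uf'X) (unitX 6 ug'Y)) (unitX 6 uh'Z).
have B := has_mean_le (has_meanB (has_mean_unit P uI') (has_mean_unit P uI))
  (has_meanZ 6 (has_meanD (has_meanD (dist _ _ ufX uf'X) (dist _ _ ugY ug'Y))
    (dist _ _ uhZ uh'Z))).
lapply B => [{}B|{B} w]; last first.
  have := monom6_lip (ufX.2 w) (ugY.2 w) (uhZ.2 w) (uf'X.2 w) (ug'Y.2 w) (uh'Z.2 w).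
  by rewrite distrC => /(le_trans _); apply; exact: ler_norm.
move: A; rewrite ler_distl => /andP[_ A].
move: A B RH' ff gg hh a1 a2 a3; set I := \int[P]_w (_ * _); set I' := \int[P]_w (_ * _).
move=> *; lra.
Qed.

(** Goodness under [P] is applied to the functions averaged over the second component, then goodness
    under [Q] to the sections at each fixed [w]. *)
Lemma prod_bound_tensor (d d' dS dS' : measure_display) (T : measurableType d)
    (T' : measurableType d') (S : measurableType dS) (S' : measurableType dS')
    (R : realType) (P : probability T R) (Q : probability T' R)
    (U V W : T -> S) (U' V' W' : T' -> S') (f g h : S * S' -> R) :
  measurable_fun setT U -> measurable_fun setT V -> measurable_fun setT W ->
  measurable_fun setT U' -> measurable_fun setT V' -> measurable_fun setT W' ->
  prod_bound P U V W -> prod_bound Q U' V' W' ->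
  unit_fun f -> unit_fun g -> unit_fun h ->
  (\int[P]_w (\int[Q]_w' f (U w, U' w'))) ^+ 6 *
  (\int[P]_w (\int[Q]_w' g (V w, V' w'))) ^+ 6 *
  (\int[P]_w (\int[Q]_w' h (W w, W' w'))) ^+ 6 <=
  \int[P]_w (\int[Q]_w' (f (U w, U' w') ^+ 6 * g (V w, V' w') ^+ 6 *
                         h (W w, W' w') ^+ 6)).
Proof.
move=> mU mV mW mU' mV' mW' PB QB uf ug uh.
have um (k : S * S' -> R) (K : T' -> S') : unit_fun k -> measurable_fun setT K ->
    unit_fun (fun s => \int[Q]_w' k (s, K w')).
  move=> uk mK.
  apply: (@unit_mean2 _ _ S T' R Q (fun z : S * T' => k (z.1, K z.2))).
  apply: (unit_comp uk); apply: measurable_fun_pair => //.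
  exact: measurableT_comp.
have [[uF uG] uH] := (um _ _ uf mU', um _ _ ug mV', um _ _ uh mW').
apply: (le_trans (PB _ _ _ uF uG uH)).
have up (k : S * S' -> R) (K : T -> S) (K' : T' -> S') : unit_fun k ->
    measurable_fun setT K -> measurable_fun setT K' ->
    unit_fun (fun z : T * T' => k (K z.1, K' z.2)).
  by move=> uk mK mK'; apply: (unit_comp uk); apply: measurable_fun_pair;
    exact: measurableT_comp.
have uin := unitM (unitM (unitX 6 (up _ _ _ uf mU mU')) (unitX 6 (up _ _ _ ug mV mV')))
  (unitX 6 (up _ _ _ uh mW mW')).
have uout := unitM (unitM (unitX 6 (unit_comp uF mU)) (unitX 6 (unit_comp uG mV)))
  (unitX 6 (unit_comp uH mW)).
apply: (has_mean_le (has_mean_unit P uout) (has_mean_unit P (unit_mean2 Q uin))) => w.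
apply: (QB (fun s => f (U w, s)) (fun s => g (V w, s)) (fun s => h (W w, s))).
- by apply: (unit_comp uf); exact: measurable_pair1.
- by apply: (unit_comp ug); exact: measurable_pair1.
- by apply: (unit_comp uh); exact: measurable_pair1.
Qed.

(** * Independent tuples and their joint laws *)

Definition boxes (dS : measure_display) (S : measurableType dS) (n : nat) :
    set (set (n.-tuple S)) :=
  [set B | exists2 D : 'I_n -> set S, (forall i, measurable (D i)) &
     B = [set t | forall i, D i (tnth t i)]].
Arguments boxes {dS} S n _.

Section Independence.
Context d dS (T : measurableType d) (S : measurableType dS) (R : realType).
Variable P : probability T R.

Lemma mutually_independent_inj (I I' : finType) (s : I' -> I) (Y : I -> T -> S) :
  injective s -> mutually_independent P Y -> mutually_independent P (Y \o s).
Proof.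
move=> sI indY J B mB.
(* The default [setT] only has to be measurable: indices outside the image of [s] do not belong to
   [s @: J]. *)
pose B0 i := if [pick j | s j == i] is Some j then B j else setT.
have B0s j : B0 (s j) = B j.
  rewrite /B0; case: pickP => [k /eqP/sI -> //|/(_ j)].
  by rewrite eqxx.
have mB0 i : measurable (B0 i) by rewrite /B0; case: pickP.
have := indY (s @: J) B0 mB0.
rewrite big_imset/=; last by move=> i j _ _; exact: sI.
rewrite (eq_bigr (fun j => P ((Y \o s) j @^-1` B j)))/=; last first.
  by move=> j _; rewrite B0s.
move=> <-; congr (P _); apply/seteqP; split => w /= YB.
  by move=> _ /imsetP[j jJ ->]; rewrite B0s; exact: YB.
by move=> j jJ; rewrite -B0s; apply: YB; exact: imset_f.
Qed.

Lemma measurable_boxes n :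
  boxes S n `<=` @measurable (measure_tuple_display dS) (n.-tuple S).
Proof.
move=> _ [D mD ->].
rewrite (_ : [set _ | _] = \bigcap_(i in [set: 'I_n])
  ((fun t : n.-tuple S => tnth t i) @^-1` D i)); last first.
  by apply/seteqP; split => [t Dt i _|t Dt i]; [exact: Dt|exact: (Dt i)].
apply: fin_bigcap_measurable => // i _.
by rewrite -[X in measurable X]setTI; exact: measurable_tnth.
Qed.

Lemma measurable_tupleE n : @measurable (measure_tuple_display dS) (n.-tuple S) = <<s boxes S n >>.
Proof.
apply/seteqP; split; last first.
  by apply: smallest_sub; [exact: sigma_algebra_measurable|exact: measurable_boxes].
apply: smallest_sub; first exact: smallest_sigma_algebra.
move=> A; rewrite -bigcup_seq /= => -[i _ [B mB <-]]; rewrite setTI.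
apply: sub_sigma_algebra; exists (fun j => if j == i then B else setT).
  by move=> j; case: ifP.
apply/seteqP; split => [t /= Bt j|t /= /(_ i)]; last by rewrite eqxx.
by case: eqP => // ->.
Qed.

Variables (n : nat) (Y : 'I_n.+1 -> T -> S).
Hypothesis mY : forall i, measurable_fun setT (Y i).
Hypothesis indY : mutually_independent P Y.

Definition tail_tuple (w : T) : n.-tuple S := [tuple Y (lift ord0 k) w | k < n].

Lemma measurable_tail_tuple : measurable_fun setT tail_tuple.
Proof.
apply/measurable_fun_tnthP => i; rewrite (_ : _ \o _ = Y (lift ord0 i))//.
by apply/funext => w /=; rewrite tnth_mktuple.
Qed.

(** Mutual independence only speaks of boxes. They form a pi-system generating the sigma-algebra of
    tuples, and the product formula passes to complements and disjoint unions in [B]. *)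
Lemma indep_head_tail (A : set S) (B : set (n.-tuple S)) :
  measurable A -> measurable B ->
  P (Y ord0 @^-1` A `&` tail_tuple @^-1` B) =
  (P (Y ord0 @^-1` A) * P (tail_tuple @^-1` B))%E.
Proof.
move=> mA; rewrite measurable_tupleE.
have mpreT (C : set (n.-tuple S)) : measurable C -> measurable (tail_tuple @^-1` C).
  by move=> mC; rewrite -[X in measurable X]setTI; exact: measurable_tail_tuple.
have mpre0 : measurable (Y ord0 @^-1` A).
  by rewrite -[X in measurable X]setTI; exact: mY.
apply: (@dynkin_induction _ (n.-tuple S) (boxes S n) (fun B =>
    P (Y ord0 @^-1` A `&` tail_tuple @^-1` B) =
    (P (Y ord0 @^-1` A) * P (tail_tuple @^-1` B))%E)).
- exact: measurable_tupleE.
- move=> _ _ [D mD ->] [D' mD' ->]; exists (fun i => D i `&` D' i).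
    by move=> i; exact: measurableI.
  apply/seteqP; split => [t /= [Dt D't] i|t /= DD'].
    by split; [exact: Dt|exact: D't].
  by split => i; have [] := DD' i.
- by rewrite preimage_setT setIT probability_setT mule1.
- move=> _ [D mD ->].
  have box (E0 : set S) : measurable E0 ->
      P (Y ord0 @^-1` E0 `&` tail_tuple @^-1` [set t | forall i, D i (tnth t i)]) =
      (P (Y ord0 @^-1` E0) * \prod_(k < n) P (Y (lift ord0 k) @^-1` D k))%E.
    move=> mE0; pose E i := if unlift ord0 i is Some k then D k else E0.
    have mE i : measurable (E i) by rewrite /E; case: unliftP.
    have := indY [set: 'I_n.+1]%SET mE.
    rewrite (eq_bigl xpredT); last by move=> i; rewrite inE.
    have E0E : E ord0 = E0 by rewrite /E unlift_none.
    have ED k : E (lift ord0 k) = D k by rewrite /E liftK.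
    rewrite big_ord_recl/= E0E; under eq_bigr do rewrite ED.
    move=> <-; congr (P _); apply/seteqP; split => w /=.
      move=> [Yw Dw] i _; case: (unliftP ord0 i) => [k ->|->]; last by rewrite E0E.
      rewrite ED.
      by have := Dw k; rewrite tnth_mktuple.
    move=> Ew; split; first by rewrite -E0E; apply: Ew; rewrite inE.
    by move=> k; rewrite tnth_mktuple -ED; apply: Ew; rewrite inE.
  rewrite box//; congr (_ * _)%E.
  (* With the whole space in the first slot, [box] identifies the product over the remaining indices
     with the probability of the tail box. *)
  have := box setT measurableT.
  by rewrite preimage_setT setTI probability_setT mul1e.
- move=> B' mB' IH; rewrite preimage_setC.
  have Dpart : P (Y ord0 @^-1` A `\` tail_tuple @^-1` B') =
      (P (Y ord0 @^-1` A) - P (Y ord0 @^-1` A `&` tail_tuple @^-1` B'))%E.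
    apply: measureD => //; first exact: mpreT.
    exact: (le_lt_trans (probability_le1 P mpre0)) (ltry 1).
  rewrite -setDE Dpart IH probability_setC; last exact: mpreT.
  by rewrite muleBr ?mule1 ?fin_num_adde_defr//; exact: fin_num_measure.
- move=> F mF tF IH; rewrite preimage_bigcup setI_bigcupr.
  have tF' : trivIset setT (fun k => tail_tuple @^-1` F k).
    by move=> i j _ _ [w [Fi Fj]]; apply: (tF i j) => //; exists (tail_tuple w).
  rewrite measure_bigcup//; last 2 first.
  - by move=> k _; apply: measurableI => //; exact: mpreT.
  - by move=> i j _ _ [w [[_ Fi] [_ Fj]]]; apply: (tF' i j) => //; exists w.
  rewrite measure_bigcup//; last by move=> k _; exact: mpreT.
  have PA : P (Y ord0 @^-1` A) \is a fin_num by exact: fin_num_measure.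
  rewrite -(fineK PA) -nneseriesZl//.
  by apply: eq_eseriesr => k _; rewrite fineK//; exact: IH.
Qed.

End Independence.

Lemma mean_distribution (d dS : measure_display) (T : measurableType d)
    (S : measurableType dS) (R : realType) (P : probability T R)
    (X : {mfun T >-> S}) (f : S -> R) : unit_fun f ->
  \int[distribution P X]_s f s = \int[P]_w f (X w).
Proof.
move=> [mf f01]; rewrite /Rintegral ge0_integral_distribution//.
  exact/measurable_EFinP.
by move=> s; rewrite lee_fin; case/andP: (f01 s).
Qed.

Lemma mean_same_law (d1 d2 dS : measure_display) (T1 : measurableType d1)
    (T2 : measurableType d2) (S : measurableType dS) (R : realType)
    (P1 : probability T1 R) (P2 : probability T2 R) (X1 : T1 -> S) (X2 : T2 -> S)
    (f : S -> R) :
  measurable_fun setT X1 -> measurable_fun setT X2 -> same_law P1 P2 X1 X2 ->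
  unit_fun f -> \int[P1]_w f (X1 w) = \int[P2]_w f (X2 w).
Proof.
move=> m1 m2 law uf.
have := mean_distribution P1 (mfun_Sub (mem_set m1 : X1 \in mfun)) uf.
have := mean_distribution P2 (mfun_Sub (mem_set m2 : X2 \in mfun)) uf.
move=> <- <-; congr fine; apply: eq_measure_integral => A mA _.
exact: law.
Qed.

(** The product formula on rectangles determines the law of the pair as the product of the two laws;
    the rest is Fubini and transport of means. *)
Lemma mean_indep (d dS dS' : measure_display) (T : measurableType d)
    (S : measurableType dS) (S' : measurableType dS') (R : realType)
    (P : probability T R) (U : T -> S) (V : T -> S') (F : S * S' -> R) :
  measurable_fun setT U -> measurable_fun setT V ->
  (forall A B, measurable A -> measurable B ->
     P (U @^-1` A `&` V @^-1` B) = (P (U @^-1` A) * P (V @^-1` B))%E) ->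
  unit_fun F ->
  \int[P]_w F (U w, V w) = \int[P]_w (\int[P]_w' F (U w, V w')).
Proof.
move=> mU mV indep uF.
pose U0 : {mfun T >-> S} := mfun_Sub (mem_set mU : U \in mfun).
pose V0 : {mfun T >-> S'} := mfun_Sub (mem_set mV : V \in mfun).
have mUV : measurable_fun setT (fun w => (U w, V w)) by exact: measurable_fun_pair.
pose UV : {mfun T >-> (S * S')%type} := mfun_Sub (mem_set mUV : _ \in mfun).
have uFV s : unit_fun (fun s' => F (s, s')).
  by apply: (unit_comp uF); exact: measurable_pair1.
transitivity (\int[distribution P UV]_z F z).
  by rewrite mean_distribution.
transitivity (\int[distribution P U0]_s (\int[distribution P V0]_s' F (s, s'))).
  rewrite unit_fubini//; congr fine; apply: eq_measure_integral => A mA _.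
  by apply/esym; apply: (@product_measure_unique _ _ S S' R (distribution P U0)
    (distribution P V0) (distribution P UV)).
rewrite (mean_distribution P U0 (unit_mean2 (distribution P V0) uF)).
by apply: eq_Rintegral => w _; rewrite mean_distribution.
Qed.

Section TupleBound.
Context d (T : measurableType d) (R : realType) (P : probability T R).

Lemma measurable_coordinates n p (Y : 'I_n -> T -> p.-tuple R) i :
  (forall k, measurable_fun setT (Y k)) -> measurable_fun setT (coordinates Y i).
Proof.
move=> mY; apply/measurable_fun_tnthP => k.
rewrite (_ : _ \o _ = (fun t : p.-tuple R => tnth t i) \o Y k).
  by apply: measurableT_comp => //; exact: measurable_tnth.
by apply/funext => w /=; rewrite tnth_mktuple.
Qed.

Lemma coordinates_cons n p (Y : 'I_n.+1 -> T -> p.-tuple R) i w :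
  coordinates Y i w =
  [the n.+1.-tuple R of tnth (Y ord0 w) i :: coordinates (Y \o lift ord0) i w].
Proof.
apply: eq_from_tnth => k; rewrite tnth_mktuple.
by case: (unliftP ord0 k) => [j ->|->]; rewrite ?tnthS ?tnth_mktuple// tnth0.
Qed.

Lemma measurable_fun_cons n :
  measurable_fun setT (fun z : R * n.-tuple R => [the n.+1.-tuple R of z.1 :: z.2]).
Proof. exact: measurable_cons. Qed.

Lemma mean_coordinates n p (Y : 'I_n.+1 -> T -> p.-tuple R)
    (F : p.-tuple R -> n.-tuple (p.-tuple R) -> R) :
  (forall k, measurable_fun setT (Y k)) -> mutually_independent P Y ->
  unit_fun (fun z : p.-tuple R * n.-tuple (p.-tuple R) => F z.1 z.2) ->
  \int[P]_w F (Y ord0 w) (tail_tuple Y w) =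
  \int[P]_w (\int[P]_w' F (Y ord0 w) (tail_tuple Y w')).
Proof.
move=> mY indY uF.
apply: (mean_indep (F := fun z => F z.1 z.2)) => //.
  exact: measurable_tail_tuple.
by move=> A B mA mB; exact: indep_head_tail.
Qed.

Lemma prod_bound_coordinates n p (Y : 'I_n -> T -> p.-tuple R) (a b c : 'I_p) :
  (forall k, measurable_fun setT (Y k)) -> mutually_independent P Y ->
  (forall k, prod_bound P (fun w => tnth (Y k w) a) (fun w => tnth (Y k w) b)
     (fun w => tnth (Y k w) c)) ->
  prod_bound P (coordinates Y a) (coordinates Y b) (coordinates Y c).
Proof.
elim: n Y => [|n IH] Y mY indY PB f g h uf ug uh.
  have E (k : 0.-tuple R -> R) i w : k (coordinates Y i w) = k [tuple].
    by rewrite [coordinates _ _ _]tuple0.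
  under eq_Rintegral do rewrite E.
  under [X in _ * X ^+ 6 * _]eq_Rintegral do rewrite E.
  under [X in _ * X ^+ 6]eq_Rintegral do rewrite E.
  under [X in _ <= X]eq_Rintegral do rewrite !E.
  by rewrite !mean_cst.
pose Y' := Y \o lift ord0.
have mY' k : measurable_fun setT (Y' k) by exact: mY.
have indY' : mutually_independent P Y'.
  by apply: mutually_independent_inj => //; exact: lift_inj.
have IHY' := IH Y' mY' indY' (fun k => PB (lift ord0 k)).
(* Independence holds between the first vector and the tuple of all the others, so the i-th
   coordinates must be read off from that single tuple. *)
pose col i (t : n.-tuple (p.-tuple R)) : n.-tuple R := [tuple tnth (tnth t k) i | k < n].
have colE i w : coordinates Y' i w = col i (tail_tuple Y w).
  by apply: eq_from_tnth => k; rewrite !tnth_mktuple.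
have mcol i : measurable_fun setT (col i).
  apply/measurable_fun_tnthP => k.
  rewrite (_ : _ \o _ = (fun t : p.-tuple R => tnth t i) \o
    (fun t : n.-tuple (p.-tuple R) => tnth t k)).
    by apply: measurableT_comp; exact: measurable_tnth.
  by apply/funext => t /=; rewrite tnth_mktuple.
pose cons2 i (y : p.-tuple R) t := [the n.+1.-tuple R of tnth y i :: col i t].
have ucons2 i (k : n.+1.-tuple R -> R) : unit_fun k ->
    unit_fun (fun z : p.-tuple R * n.-tuple (p.-tuple R) => k (cons2 i z.1 z.2)).
  move=> uk; apply: (unit_comp uk); apply: measurable_cons.
    apply: (measurableT_comp (f := fun t : p.-tuple R => tnth t i)) => //.
    exact: measurable_tnth.
  exact: measurableT_comp.
have E (k : n.+1.-tuple R -> R) i w :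
    k (coordinates Y i w) = k (cons2 i (Y ord0 w) (tail_tuple Y w)).
  by rewrite coordinates_cons colE.
under eq_Rintegral do rewrite E.
under [X in _ * X ^+ 6 * _]eq_Rintegral do rewrite E.
under [X in _ * X ^+ 6]eq_Rintegral do rewrite E.
under [X in _ <= X]eq_Rintegral do rewrite !E.
have mean2 i k : unit_fun k -> \int[P]_w k (cons2 i (Y ord0 w) (tail_tuple Y w)) =
    \int[P]_w (\int[P]_w' k (cons2 i (Y ord0 w) (tail_tuple Y w'))).
  move=> uk; apply: (mean_coordinates (F := fun y t => k (cons2 i y t))) => //.
  exact: ucons2.
rewrite (mean2 a f uf) (mean2 b g ug) (mean2 c h uh).
rewrite [leRHS](mean_coordinates (F := fun y t => f (cons2 a y t) ^+ 6 *
    g (cons2 b y t) ^+ 6 * h (cons2 c y t) ^+ 6) mY indY); last first.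
  exact: (unitM (unitM (unitX 6 (ucons2 a f uf)) (unitX 6 (ucons2 b g ug)))
    (unitX 6 (ucons2 c h uh))).
have mt i : measurable_fun setT (fun w => tnth (Y ord0 w) i).
  by apply: (measurableT_comp (f := fun t : p.-tuple R => tnth t i)) => //;
    exact: measurable_tnth.
have uc k : unit_fun k ->
    unit_fun (fun z : R * n.-tuple R => k [the n.+1.-tuple R of z.1 :: z.2] : R).
  by move=> uk; apply: (unit_comp uk); exact: measurable_fun_cons.
have := prod_bound_tensor (mt a) (mt b) (mt c) (measurable_coordinates a mY')
  (measurable_coordinates b mY') (measurable_coordinates c mY') (PB ord0) IHY'
  (uc _ uf) (uc _ ug) (uc _ uh).
rewrite /=.
have E2 (k : n.+1.-tuple R -> R) i w w' :
    k [the n.+1.-tuple R of tnth (Y ord0 w) i :: coordinates Y' i w'] =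
    k (cons2 i (Y ord0 w) (tail_tuple Y w')) by rewrite /cons2 -colE.
under eq_Rintegral do under eq_Rintegral do rewrite E2.
under [X in _ * X ^+ 6 * _]eq_Rintegral do under eq_Rintegral do rewrite E2.
under [X in _ * X ^+ 6]eq_Rintegral do under eq_Rintegral do rewrite E2.
by under [X in _ <= X]eq_Rintegral do under eq_Rintegral do rewrite !E2.
Qed.

End TupleBound.

(** * Stability of Gaussian vectors *)

Section NormalStable.
Variable R : realType.
Local Notation mu := (@lebesgue_measure R).
Local Notation phi := (@normal_pdf R 0 1).
Local Notation gam := (@normal_prob R 0 1).

(** The image of Lebesgue measure under the affine map, scaled by [a], gives every interval its
    length, hence is Lebesgue measure by uniqueness. *)
Lemma ge0_integral_affine (a b : R) (g : R -> \bar R) : 0 < a ->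
  measurable_fun setT g -> (forall x, 0 <= g x)%E ->
  (\int[mu]_x g x = a%:E * \int[mu]_x g (a * x + b)%R)%E.
Proof.
move=> a0 mg g0.
pose MR : measurableType _ := measurableTypeR R.
have maff : measurable_fun (T := MR) (U := MR) setT (fun x => a * x + b).
  by apply: measurable_funD => //; exact: measurable_funM.
pose push : {measure set MR -> \bar R} :=
  measure_function_pushforward__canonical__measure_function_Measure mu maff.
have a0' : 0 <= a by exact: ltW.
pose nu := mscale (NngNum a0') push.
have nuE A : measurable A -> mu A = nu A.
  apply: lebesgue_measure_unique => _ [[c d'] /= _ <-].
  rewrite /nu /mscale /= /pushforward/=.
  rewrite (_ : _ @^-1` _ = `](c - b) / a, (d' - b) / a]%classic); last first.
    apply/seteqP; split => x /=; rewrite !in_itv/= ltr_pdivrMr// ler_pdivlMr//;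
      by rewrite ltrBlDr lerBrDr mulrC.
  rewrite !lebesgue_measure_itv/= !lte_fin ltr_pM2r ?invr_gt0// ltrD2r.
  case: ifPn => _; last by rewrite mule0.
  by rewrite -!EFinD -EFinM; congr (_%:E); field; rewrite gt_eqF.
rewrite (eq_measure_integral nu); last by move=> A mA _; exact: nuE.
rewrite ge0_integral_mscale//; congr (_ * _)%E.
by rewrite (ge0_integral_pushforward maff).
Qed.

Lemma integral_normal_prob (f : R -> R) : unit_fun f ->
  (\int[gam]_x (f x)%:E = \int[mu]_x (f x * phi x)%:E)%E.
Proof.
move=> uf; have intf := unit_integrable gam uf.
have [mf f01] := uf.
rewrite -(Radon_Nikodym_change_of_variables (@normal_prob_dominates R 0 1))//.
under [RHS]eq_integral do rewrite EFinM.
have mphi : measurable_fun setT (EFin \o phi).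
  by apply/measurable_EFinP; exact: measurable_normal_pdf.
have mfE : measurable_fun setT (EFin \o f) by exact/measurable_EFinP.
apply: ae_eq_integral => //.
- apply: emeasurable_funM => //; apply: (measurable_int mu).
  by apply: Radon_Nikodym_integrable; exact: normal_prob_dominates.
- exact: emeasurable_funM.
- apply: ae_eqe_mul2l => /=.
  rewrite Radon_NikodymE//=; first exact: normal_prob_dominates.
  move=> domg; case: cid => /= h [h1 h2 h3].
  apply: integral_ae_eq => //=.
  by move=> E _ mE; rewrite -h3.
Qed.

(** Both exponents come from 2 x^2 + 2 u^2 - 2 sqrt 2 x u, which is symmetric in x and u. This
    identity replaces the rotation invariance of the planar Gaussian, so one-variable substitutions
    suffice. *)
Lemma normal_pdf_rotation (x u : R) :
  phi x * phi (Num.sqrt 2 * u - x) = phi u * phi (Num.sqrt 2 * x - u).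
Proof.
have s2 : Num.sqrt 2 ^+ 2 = 2 :> R by rewrite sqr_sqrtr.
have phiE z : phi z = normal_peak 1 * expR (- z ^+ 2 / (1 ^+ 2 *+ 2)).
  by rewrite normal_pdfE ?oner_neq0// /normal_fun subr0.
rewrite !phiE [LHS]mulrACA [RHS]mulrACA -!expRD -!mulrDl -!opprD.
suff -> : x ^+ 2 + (Num.sqrt 2 * u - x) ^+ 2 = u ^+ 2 + (Num.sqrt 2 * x - u) ^+ 2 by [].
move: s2; move: (Num.sqrt 2) => s s2.
have e (y z : R) : y ^+ 2 + (s * z - y) ^+ 2 = 2 * y ^+ 2 + s ^+ 2 * z ^+ 2 - 2 * s * y * z.
  by ring.
by rewrite !e s2; ring.
Qed.

(** Substitute y = sqrt 2 u - x in the inner integral, exchange the integrals and apply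
    [normal_pdf_rotation]: [f u * phi u] leaves the integral over x, and what remains is a Gaussian
    density of mass 1 after an affine substitution. *)
Lemma normal_prob_stable (f : R -> R) : unit_fun f ->
  \int[gam]_x (\int[gam]_y f ((x + y) / Num.sqrt 2)) = \int[gam]_x f x.
Proof.
move=> uf; have [mf f01] := uf.
have s0 : 0 < Num.sqrt 2 :> R by rewrite sqrtr_gt0.
have f0 x : 0 <= f x by case/andP: (f01 x).
have phi0 x : 0 <= phi x by exact: normal_pdf_ge0.
have mphi : measurable_fun setT phi by exact: measurable_normal_pdf.
have ux (x : R) : unit_fun (fun y : R => f ((x + y) / Num.sqrt 2)).
  by apply: (unit_comp uf); apply: measurable_funM => //; exact: measurable_funD.
have uxy : unit_fun (fun z : R * R => f ((z.1 + z.2) / Num.sqrt 2)).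
  by apply: (unit_comp uf); apply: measurable_funM => //; exact: measurable_funD.
have ui := unit_mean2 gam uxy; rewrite /= in ui.
rewrite /Rintegral; congr fine; rewrite !integral_normal_prob//.
have m2 : measurable_fun setT (fun z : R * R => (Num.sqrt 2 * z.2 - z.1)).
  by apply: measurable_funB => //; exact: measurable_funM.
transitivity (\int[mu]_x \int[mu]_u
    (f u * (Num.sqrt 2 * (phi x * phi (Num.sqrt 2 * u - x))))%:E)%E.
  apply: eq_integral => x _.
  rewrite EFinM fineK; last first.
    apply: (@integrable_fin_num _ _ _ gam setT) => //.
    exact: (unit_integrable gam (ux x)).
  rewrite integral_normal_prob//.
  rewrite (@ge0_integral_affine (Num.sqrt 2) (- x))//; last 2 first.
  - apply/measurable_EFinP; apply: measurable_funM => //.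
    by case: (ux x).
  - by move=> y; rewrite lee_fin mulr_ge0.
  have mg : measurable_fun setT (fun u : R => f u * phi (Num.sqrt 2 * u - x)).
    apply: measurable_funM => //; apply: measurableT_comp => //.
    by apply: measurable_funB => //; exact: measurable_funM.
  under eq_integral => u _.
    rewrite (_ : (x + (Num.sqrt 2 * u + - x)) / Num.sqrt 2 = u); last first.
      by field; rewrite gt_eqF.
    over.
  rewrite -ge0_integralZl; [|by []|exact/measurable_EFinP
    |by move=> u _; rewrite lee_fin mulr_ge0|by rewrite lee_fin ltW].
  rewrite -ge0_integralZr; [|by []|by apply/measurable_EFinP; exact: measurable_funM
    |by move=> u _; rewrite -EFinM lee_fin !mulr_ge0// ltW|by rewrite lee_fin].
  by apply: eq_integral => u _; rewrite -!EFinM; congr (_%:E); ring.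
transitivity (\int[mu]_u \int[mu]_x
    (f u * (Num.sqrt 2 * (phi x * phi (Num.sqrt 2 * u - x))))%:E)%E.
  apply: (fubini_tonelli (m1 := mu) (m2 := mu) (fun z : R * R =>
    (f z.2 * (Num.sqrt 2 * (phi z.1 * phi (Num.sqrt 2 * z.2 - z.1))))%:E)).
    apply/measurable_EFinP; apply: measurable_funM; first exact: measurableT_comp.
    by apply: measurable_funM => //; apply: measurable_funM; exact: measurableT_comp.
  by move=> z; rewrite lee_fin !mulr_ge0// ltW.
apply: eq_integral => u _.
transitivity (\int[mu]_x ((f u * phi u)%:E * ((Num.sqrt 2)%:E * (phi (Num.sqrt 2 * x - u))%:E)))%E.
  apply: eq_integral => x _; rewrite normal_pdf_rotation -!EFinM; congr (_%:E); ring.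
have mphis : measurable_fun setT (fun x : R => phi (Num.sqrt 2 * x - u)).
  apply: measurableT_comp => //.
  by apply: measurable_funB => //; exact: measurable_funM.
rewrite ge0_integralZl; [|by []|by apply: measurable_funeM; exact/measurable_EFinP
  |by move=> x _; rewrite -EFinM lee_fin mulr_ge0// ltW|by rewrite lee_fin mulr_ge0].
rewrite ge0_integralZl; [|by []|exact/measurable_EFinP
  |by move=> x _; rewrite lee_fin|by rewrite lee_fin ltW].
rewrite -(ge0_integral_affine (- u) s0 (g := EFin \o phi)); last 2 first.
- exact/measurable_EFinP.
- by move=> x; rewrite lee_fin.
by rewrite integral_normal_pdf mule1.
Qed.

End NormalStable.

Section TupleStable.
Context d (T : measurableType d) (R : realType) (P : probability T R).

Definition scaled_sum n (s t : n.-tuple R) : n.-tuple R :=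
  [tuple (tnth s k + tnth t k) / Num.sqrt 2 | k < n].

Lemma measurable_scaled_sum n d' (T' : measurableType d') (f g : T' -> n.-tuple R) :
  measurable_fun setT f -> measurable_fun setT g ->
  measurable_fun setT (fun x => scaled_sum (f x) (g x)).
Proof.
move=> mf mg; apply/measurable_fun_tnthP => k.
rewrite (_ : _ \o _ = fun x => (tnth (f x) k + tnth (g x) k) / Num.sqrt 2); last first.
  by apply/funext => x /=; rewrite tnth_mktuple.
apply: measurable_funM => //; apply: measurable_funD.
  exact: (measurableT_comp (@measurable_tnth _ _ _ k) mf).
exact: (measurableT_comp (@measurable_tnth _ _ _ k) mg).
Qed.

Lemma scaled_sum_cons n (x y : R) (s t : n.-tuple R) :
  scaled_sum [the n.+1.-tuple R of x :: s] [the n.+1.-tuple R of y :: t] =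
  [the n.+1.-tuple R of (x + y) / Num.sqrt 2 :: scaled_sum s t].
Proof.
apply: eq_from_tnth => k; rewrite tnth_mktuple.
by case: (unliftP ord0 k) => [j ->|->]; rewrite ?tnthS ?tnth_mktuple// !tnth0.
Qed.

Lemma standard_normal_stable (Z : T -> R) (f : R -> R) : measurable_fun setT Z ->
  standard_normal P Z -> unit_fun f ->
  \int[P]_w' (\int[P]_w f ((Z w' + Z w) / Num.sqrt 2)) = \int[P]_w f (Z w).
Proof.
move=> mZ nZ uf.
have mid : measurable_fun (T := measurableTypeR R) (U := R) setT (fun x => x).
  exact: measurable_id.
have law : same_law (T' := R) P (normal_prob 0 1) Z (fun x : measurableTypeR R => x).
  by move=> B mB; rewrite nZ.
have ms x : measurable_fun setT (fun y : R => (x + y) / Num.sqrt 2).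
  by apply: measurable_funM => //; exact: measurable_funD.
have u2 : unit_fun (fun z : R * R => f ((z.1 + z.2) / Num.sqrt 2)).
  by apply: (unit_comp uf); apply: measurable_funM => //; exact: measurable_funD.
pose G (x : R) : R := \int[normal_prob 0 1]_y f ((x + y) / Num.sqrt 2).
have uG : unit_fun G.
  exact: (@unit_mean2 _ _ R (measurableTypeR R) R (normal_prob 0 1)
    (fun z => f ((z.1 + z.2) / Num.sqrt 2))).
transitivity (\int[P]_w' G (Z w')).
  apply: eq_Rintegral => w' _.
  exact: (mean_same_law mZ mid law (unit_comp uf (ms (Z w')))).
rewrite (mean_same_law mZ mid law uG) (mean_same_law mZ mid law uf).
exact: normal_prob_stable.
Qed.

Lemma normal_tuple_stable n (Z : 'I_n -> T -> R) (F : n.-tuple R -> R) :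
  (forall k, measurable_fun setT (Z k)) -> mutually_independent P Z ->
  (forall k, standard_normal P (Z k)) -> unit_fun F ->
  \int[P]_w' (\int[P]_w F (scaled_sum [tuple Z k w' | k < n] [tuple Z k w | k < n])) =
  \int[P]_w F [tuple Z k w | k < n].
Proof.
elim: n Z F => [|n IH] Z F mZ indZ nZ uF.
  under eq_Rintegral do under eq_Rintegral do rewrite [scaled_sum _ _]tuple0.
  under [RHS]eq_Rintegral do rewrite [mktuple _]tuple0.
  by rewrite !mean_cst.
pose Z0 := Z ord0; pose t := tail_tuple Z.
have tE w : [tuple Z k w | k < n.+1] = [the n.+1.-tuple R of Z0 w :: t w].
  apply: eq_from_tnth => k; rewrite tnth_mktuple.
  by case: (unliftP ord0 k) => [j ->|->]; rewrite ?tnthS ?tnth_mktuple// tnth0.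
have mt : measurable_fun setT t by exact: measurable_tail_tuple.
have mZ0 : measurable_fun setT Z0 by exact: mZ.
pose G x (s : n.-tuple R) := F [the n.+1.-tuple R of x :: s].
have uG : unit_fun (fun z : R * n.-tuple R => G z.1 z.2).
  by apply: (unit_comp uF); exact: measurable_cons.
have indep (K : R * n.-tuple R -> R) : unit_fun K ->
    \int[P]_w K (Z0 w, t w) = \int[P]_w (\int[P]_w' K (Z0 w, t w')).
  by move=> uK; apply: mean_indep => // A B mA mB; exact: indep_head_tail.
under eq_Rintegral do under eq_Rintegral do rewrite !tE scaled_sum_cons.
under [RHS]eq_Rintegral do rewrite tE.
have uGc d' (T' : measurableType d') (a : T' -> R) (b : T' -> n.-tuple R) :
    measurable_fun setT a -> measurable_fun setT b -> unit_fun (fun x => G (a x) (b x)).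
  by move=> ma mb; exact: (unit_comp uG (measurable_fun_pair ma mb)).
pose av x y : R := (x + y) / Num.sqrt 2.
have mav d' (T' : measurableType d') (a b : T' -> R) :
    measurable_fun setT a -> measurable_fun setT b ->
    measurable_fun setT (fun x => av (a x) (b x)).
  by move=> ma mb; apply: measurable_funM => //; exact: measurable_funD.
transitivity (\int[P]_w' (\int[P]_w1 (\int[P]_w2
    G (av (Z0 w') (Z0 w1)) (scaled_sum (t w') (t w2))))).
  apply: eq_Rintegral => w' _.
  apply: (indep (fun z => G (av (Z0 w') z.1) (scaled_sum (t w') z.2))).
  by apply: uGc; [exact: mav|exact: measurable_scaled_sum].
pose K (z : R * n.-tuple R) := \int[P]_w1 (\int[P]_w2
  G (av z.1 (Z0 w1)) (scaled_sum z.2 (t w2))).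
have uK : unit_fun K.
  apply: (@unit_mean2 _ _ (R * n.-tuple R)%type T R P (fun z =>
    \int[P]_w2 G (av z.1.1 (Z0 z.2)) (scaled_sum z.1.2 (t w2)))).
  apply: (@unit_mean2 _ _ ((R * n.-tuple R) * T)%type T R P (fun z =>
    G (av z.1.1.1 (Z0 z.1.2)) (scaled_sum z.1.1.2 (t z.2)))).
  apply: uGc; [apply: mav|apply: measurable_scaled_sum].
  - by do 2 apply: measurableT_comp => //.
  - by do 2 apply: measurableT_comp => //.
  - by do 2 apply: measurableT_comp => //.
  - exact: measurableT_comp.
rewrite (indep K uK) /K/=.
(* The exchange brings the two tails innermost, where the induction hypothesis applies with both
   heads frozen; the one-dimensional case then treats the heads. *)
transitivity (\int[P]_w1' (\int[P]_w1 (\int[P]_w2' (\int[P]_w2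
    G (av (Z0 w1') (Z0 w1)) (scaled_sum (t w2') (t w2)))))).
  apply: eq_Rintegral => w1' _.
  apply: (@unit_fubini_swap _ _ T T R P P (fun z => \int[P]_w2
    G (av (Z0 w1') (Z0 z.2)) (scaled_sum (t z.1) (t w2)))).
  apply: (@unit_mean2 _ _ (T * T)%type T R P (fun z =>
    G (av (Z0 w1') (Z0 z.1.2)) (scaled_sum (t z.1.1) (t z.2)))).
  apply: uGc; [apply: mav => //|apply: measurable_scaled_sum].
  - by do 2 apply: measurableT_comp => //.
  - by do 2 apply: measurableT_comp => //.
  - exact: measurableT_comp.
transitivity (\int[P]_w1' (\int[P]_w1 (\int[P]_w2 G (av (Z0 w1') (Z0 w1)) (t w2)))).
  apply: eq_Rintegral => w1' _; apply: eq_Rintegral => w1 _.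
  apply: (IH (Z \o lift ord0) (G (av (Z0 w1') (Z0 w1)))).
  - by move=> k; exact: mZ.
  - by apply: mutually_independent_inj => //; exact: lift_inj.
  - by move=> k; exact: nZ.
  - exact: uGc.
have uH : unit_fun (fun x => \int[P]_w2 G x (t w2)).
  apply: (@unit_mean2 _ _ R T R P (fun z => G z.1 (t z.2))).
  by apply: uGc => //; exact: measurableT_comp.
rewrite (standard_normal_stable mZ0 (nZ ord0) uH).
by rewrite -(indep (fun z => G z.1 z.2)).
Qed.

End TupleStable.

Section GaussianStable.
Context d (T : measurableType d) (R : realType) (P : probability T R).

(* Comparing means in this identity shows that the drift [c] vanishes for
   centered vectors. *)
Lemma jointly_gaussian_stable p (X : T -> p.-tuple R) : measurable_fun setT X ->
  jointly_gaussian P X -> exists c : 'I_p -> R,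
  forall F : p.-tuple R -> R, unit_fun F ->
  \int[P]_w' (\int[P]_w F (scaled_sum (X w') (X w))) =
  \int[P]_w F [tuple tnth (X w) i + c i | i < p].
Proof.
move=> mX [l [m [A [d0 [T0 [P0 [Z [indZ nZ law]]]]]]]].
have s2 : Num.sqrt 2 != 0 :> R by rewrite sqrtr_eq0 -ltNge.
(* The means add up to 2 m / sqrt 2 = sqrt 2 m, which exceeds m by (sqrt 2 - 1) m. *)
exists (fun i => (Num.sqrt 2 - 1) * m i) => F uF.
pose lin (z : l.-tuple R) : p.-tuple R :=
  [tuple m i + \sum_(j < l) A i j * tnth z j | i < p].
pose Zt w := [tuple Z k w | k < l].
have linZ w : [tuple m i + \sum_(j < l) A i j * Z j w | i < p] = lin (Zt w).
  apply: eq_from_tnth => i; rewrite !tnth_mktuple; congr (_ + _).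
  by apply: eq_bigr => j _; rewrite tnth_mktuple.
have mlin : measurable_fun setT lin.
  apply/measurable_fun_tnthP => i.
  rewrite (_ : _ \o _ = fun z => m i + \sum_(j < l) A i j * tnth z j); last first.
    by apply/funext => z /=; rewrite tnth_mktuple.
  apply: measurable_funD => //; apply: measurable_sum => j.
  by apply: measurable_funM => //; exact: measurable_tnth.
have mZt : measurable_fun setT Zt.
  apply/measurable_fun_tnthP => k; rewrite (_ : _ \o _ = Z k)//.
  by apply/funext => w /=; rewrite tnth_mktuple.
have mlinZ : measurable_fun setT (lin \o Zt) by exact: measurableT_comp.
have {}law : same_law P P0 X (lin \o Zt).
  move=> B mB; rewrite law//; congr (P0 (_ @^-1` B)).
  by apply/funext => w /=; rewrite linZ.
have mean_law G : unit_fun G -> \int[P]_w G (X w) = \int[P0]_w G (lin (Zt w)).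
  by move=> uG; exact: (mean_same_law mX mlinZ law).
pose sh (x : p.-tuple R) : p.-tuple R :=
  [tuple tnth x i + (Num.sqrt 2 - 1) * m i | i < p].
have msh : measurable_fun setT sh.
  apply/measurable_fun_tnthP => i.
  rewrite (_ : _ \o _ = fun x => tnth x i + (Num.sqrt 2 - 1) * m i); last first.
    by apply/funext => x /=; rewrite tnth_mktuple.
  by apply: measurable_funD; [exact: measurable_tnth|exact: measurable_cst].
have sum_lin s t : scaled_sum (lin s) (lin t) = sh (lin (scaled_sum s t)).
  apply: eq_from_tnth => i; rewrite !tnth_mktuple.
  transitivity ((2 * m i + (\sum_(j < l) A i j * tnth s j + \sum_(j < l) A i j * tnth t j))
    / Num.sqrt 2); first by congr (_ / _); ring.
  rewrite -big_split/= mulrDl mulr_suml.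
  rewrite [X in _ + X](eq_bigr (fun j => A i j * tnth (scaled_sum s t) j)); last first.
    by move=> j _; rewrite tnth_mktuple -mulrDr mulrA.
  have -> : 2 * m i / Num.sqrt 2 = Num.sqrt 2 * m i.
    rewrite -[X in X * _ / _](@sqr_sqrtr _ 2)//.
    by field.
  ring.
rewrite (mean_law _ (unit_comp uF msh)).
rewrite -(normal_tuple_stable (F := fun z => F (sh (lin z))) _ indZ nZ) => //; last first.
  by apply: (unit_comp uF); exact: measurableT_comp.
have uFs : unit_fun (fun z : p.-tuple R * p.-tuple R => F (scaled_sum z.1 z.2)).
  by apply: (unit_comp uF); exact: measurable_scaled_sum.
transitivity (\int[P]_w' (\int[P0]_w F (scaled_sum (X w') (lin (Zt w))))).
  apply: eq_Rintegral => w' _; apply: (mean_law (fun x => F (scaled_sum (X w') x))).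
  by apply: (unit_comp uF); exact: measurable_scaled_sum.
rewrite (mean_law (fun x => \int[P0]_w F (scaled_sum x (lin (Zt w))))).
  by apply: eq_Rintegral => w' _; apply: eq_Rintegral => w _; rewrite sum_lin.
apply: (@unit_mean2 _ _ (p.-tuple R) T0 R P0 (fun z => F (scaled_sum z.1 (lin (Zt z.2))))).
by apply: (unit_comp uF); apply: measurable_scaled_sum => //;
  exact: (measurableT_comp mlinZ measurable_snd).
Qed.

End GaussianStable.

(** * Vanishing of the drift of a centered variable *)

Section Drift.
Context d (T : measurableType d) (R : realType) (P : probability T R).
Variables (V : T -> R) (c : R).
Hypothesis mV : measurable_fun setT V.
Hypothesis EV : has_mean P V 0.
Hypothesis stabV : forall u : R -> R, unit_fun u ->
  \int[P]_w' (\int[P]_w u ((V w' + V w) / Num.sqrt 2)) = \int[P]_w u (V w + c).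

(** Stability is known only against functions with values in [0, 1]; a truncated identity is an
    affine image of such a function. The level [n.+1] is positive, so one can divide by it. *)
Let trunc (n : nat) (x : R) : R := Num.max (- n.+1%:R) (Num.min n.+1%:R x).

Let trunc_le n x : `|trunc n x| <= n.+1%:R.
Proof.
have n0 : 0 <= n.+1%:R :> R by [].
by rewrite ler_norml /trunc; apply/andP; split;
  rewrite ?le_max ?ge_max ?ge_min lexx//= andbT; lra.
Qed.

Let trunc_le_norm n x : `|trunc n x| <= `|x|.
Proof.
have n0 : 0 <= n.+1%:R :> R by [].
rewrite ler_norml /trunc; have := ler_norm x; have := ler_norm (- x).
rewrite normrN => x1 x2; apply/andP; split.
  by rewrite le_max le_min; apply/orP; right; apply/andP; split; lra.
by rewrite ge_max ge_min x2 orbT andbT; lra.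
Qed.

Let measurable_trunc n : measurable_fun setT (trunc n).
Proof. by apply: measurable_maxr => //; exact: measurable_minr. Qed.

Let trunc_cvg x : trunc n x @[n --> \oo] --> x.
Proof.
apply: cvg_near_cst; near=> n.
have : `|x| <= n.+1%:R.
  near: n; exists (Num.truncn `|x|) => // n /= xn.
  apply: (le_trans (ltW (truncnS_gt _))); rewrite ler_nat ltnS; exact: xn.
by rewrite /trunc ler_norml => /andP[? ?]; rewrite min_r// max_r.
Unshelve. all: by end_near. Qed.

Let stab_trunc n : \int[P]_w' (\int[P]_w trunc n ((V w' + V w) / Num.sqrt 2)) =
  \int[P]_w trunc n (V w + c).
Proof.
pose N : R := n.+1%:R; have N0 : 0 < N by [].
pose u x := (trunc n x / N + 1) / 2.
have uu : unit_fun u.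
  split.
    by apply: measurable_funM => //; apply: measurable_funD => //; exact: measurable_funM.
  move=> x; have := trunc_le n x; rewrite -/N ler_norml => /andP[? ?].
  have : -1 <= trunc n x / N by rewrite ler_pdivlMr// mulN1r.
  have : trunc n x / N <= 1 by rewrite ler_pdivrMr// mul1r.
  by rewrite /u; move: (trunc n x / N) => q; lra.
have tE x : trunc n x = 2 * N * u x - N by rewrite /u; field; rewrite gt_eqF.
have maff w' : measurable_fun setT (fun w => (V w' + V w) / Num.sqrt 2).
  by apply: measurable_funM => //; exact: measurable_funD.
have u2 : unit_fun (fun z : T * T => u ((V z.1 + V z.2) / Num.sqrt 2)).
  apply: (unit_comp uu); apply: measurable_funM => //.
  by apply: measurable_funD; exact: measurableT_comp.
have shift f : unit_fun f -> \int[P]_w (2 * N * f w - N) = 2 * N * \int[P]_w f w - N.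
  by move=> uf; have [_] := has_meanB (has_meanZ (2 * N) (has_mean_unit P uf))
    (has_mean_cst P N).
under eq_Rintegral do under eq_Rintegral do rewrite tE.
under [RHS]eq_Rintegral do rewrite tE.
under eq_Rintegral => w' _.
  rewrite (shift (fun w => u ((V w' + V w) / Num.sqrt 2)) (unit_comp uu (maff w'))).
  over.
rewrite (shift _ (unit_mean2 P u2)) stabV// shift//.
by apply: (unit_comp uu); exact: measurable_funD.
Qed.

(** Testing stability against truncations of the identity and removing the truncation, the mean of
    (V' + V)/sqrt 2 is 0 while that of V + c is c. The left side takes dominated convergence twice,
    once per integral. *)
Lemma drift0 : c = 0.
Proof.
have EnV : has_mean P (fun w => `|V w|) (\int[P]_w `|V w|).
  have [intV _] := EV; split => //.
  have := integrable_norm intV.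
  by apply: eq_integrable => // w _.
have s2 : 1 <= Num.sqrt 2 :> R by rewrite -[leLHS]sqrtr1 ler_wsqrtr// ler1n.
have s20 : 0 < Num.sqrt 2 :> R by rewrite (lt_le_trans ltr01).
have avg_le a b : `|(a + b) / Num.sqrt 2| <= `|a| + `|b| :> R.
  rewrite normrM normfV (gtr0_norm s20) ler_pdivrMr//.
  apply: (le_trans (ler_normD _ _)); rewrite ler_peMr// addr_ge0//.
have maff w' : measurable_fun setT (fun w => (V w' + V w) / Num.sqrt 2).
  by apply: measurable_funM => //; exact: measurable_funD.
have rhs : \int[P]_w trunc n (V w + c) @[n --> \oo] --> c.
  have [_ EVc] := has_meanD EV (has_mean_cst P c); rewrite add0r in EVc.
  rewrite -[X in _ --> X]EVc.
  apply: (@mean_dominated_cvg _ _ _ P _ _ (fun w => `|V w| + `|c|)).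
  - by move=> n; apply: measurableT_comp => //; exact: measurable_funD.
  - by case: (has_meanD EnV (has_mean_cst P `|c|)).
  - by move=> n w; apply: (le_trans (trunc_le_norm _ _)); exact: ler_normD.
  - by move=> w; exact: trunc_cvg.
have lhs : \int[P]_w' (\int[P]_w trunc n ((V w' + V w) / Num.sqrt 2)) @[n --> \oo] --> 0.
  have [_ EVs] := has_meanZ (Num.sqrt 2)^-1 EV; rewrite mulr0 in EVs.
  rewrite -[X in _ --> X]EVs.
  apply: (@mean_dominated_cvg _ _ _ P _ _ (fun w => `|V w| + \int[P]_w' `|V w'|)).
  - move=> n.
    apply: (@measurable_mean2 _ _ T T R P (fun z =>
      trunc n ((V z.1 + V z.2) / Num.sqrt 2)) n.+1%:R); last by move=> z; exact: trunc_le.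
    apply: measurableT_comp => //; apply: measurable_funM => //.
    by apply: measurable_funD; exact: measurableT_comp.
  - by case: (has_meanD EnV (has_mean_cst P (\int[P]_w' `|V w'|))).
  - move=> n w'; have H := has_meanD (has_mean_cst P `|V w'|) EnV.
    have Htr : has_mean P (fun w => trunc n ((V w' + V w) / Num.sqrt 2))
        (\int[P]_w trunc n ((V w' + V w) / Num.sqrt 2)).
      apply: (has_mean_dom _ H); first exact: measurableT_comp.
      by move=> w; apply: (le_trans (trunc_le_norm _ _)); exact: avg_le.
    have bnd w : `|trunc n ((V w' + V w) / Num.sqrt 2)| <= `|V w'| + `|V w|.
      by apply: (le_trans (trunc_le_norm _ _)); exact: avg_le.
    rewrite ler_norml; apply/andP; split.
      apply: (has_mean_le (has_meanN H) Htr) => w.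
      by have := bnd w; rewrite ler_norml => /andP[].
    apply: (has_mean_le Htr H) => w.
    by have := bnd w; rewrite ler_norml => /andP[].
  - move=> w'.
    have [_ <-] : has_mean P (fun w => (V w' + V w) / Num.sqrt 2) ((Num.sqrt 2)^-1 * V w').
      have := has_meanZ (Num.sqrt 2)^-1 (has_meanD (has_mean_cst P (V w')) EV).
      by rewrite addr0; congr has_mean; apply/funext => w; rewrite mulrC.
    apply: (@mean_dominated_cvg _ _ _ P _ _ (fun w => `|V w'| + `|V w|)).
    + by move=> n; exact: measurableT_comp.
    + by case: (has_meanD (has_mean_cst P `|V w'|) EnV).
    + by move=> n w; apply: (le_trans (trunc_le_norm _ _)); exact: avg_le.
    + by move=> w; exact: trunc_cvg.
have lhs' : \int[P]_w trunc n (V w + c) @[n --> \oo] --> 0.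
  by move: lhs; apply: cvg_trans; apply: near_eq_cvg; apply: nearW => n; rewrite stab_trunc.
exact: (cvg_unique _ rhs lhs').
Qed.

End Drift.

(** * The Gaussian triple *)

Section Reduction.
Context d (T : measurableType d) (R : realType) (P : probability T R).
Variable X : T -> 3.-tuple R.
Hypotheses (mX : measurable_fun setT X) (gX : jointly_gaussian P X).
Hypothesis EX : forall i : 'I_3, ('E_P[(fun w => tnth (X w) i)] = 0)%E.
Hypothesis EX2 : forall i : 'I_3, ('E_P[(fun w => (tnth (X w) i ^+ 2)%R)] = 1)%E.
Hypothesis EXX : forall i j : 'I_3, i != j ->
  ('E_P[(fun w => (tnth (X w) i * tnth (X w) j)%R)] = (- (1 / 3))%:E)%E.

Let V (i : 'I_3) (w : T) : R := tnth (X w) i.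

Let mV i : measurable_fun setT (V i).
Proof. exact: (measurableT_comp (measurable_tnth i) mX). Qed.

(** A square is nonnegative, so the finite value of its expectation already yields integrability.
    The coordinates and their products are then dominated, through |x| <= 1 + x^2 and |x y| <= x^2 +
    y^2. *)
Let mean_sqr i : has_mean P (fun w => V i w ^+ 2) 1.
Proof.
have E2 := EX2 i; rewrite unlock in E2; split; last by rewrite /Rintegral E2.
apply/integrableP; split; first by apply/measurable_EFinP; exact: measurable_funX.
under eq_integral => w _ do rewrite /= ger0_norm ?sqr_ge0//.
by rewrite E2 ltry.
Qed.

Let mean_coord i : has_mean P (V i) 0.
Proof.
have [] : has_mean P (V i) (\int[P]_w V i w).
  apply: (has_mean_dom _ (has_meanD (has_mean_cst P 1) (mean_sqr i))) => // w.
  rewrite -(real_normK (num_real (V i w))); move: `|V i w| => x.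
  by have := sqr_ge0 (x - 2^-1); lra.
move=> intV _; split => //.
by have E := EX i; rewrite unlock in E; rewrite /Rintegral E.
Qed.

Let mean_prod i j : i != j -> has_mean P (fun w => V i w * V j w) (- (1 / 3)).
Proof.
move=> ij.
have [] : has_mean P (fun w => V i w * V j w) (\int[P]_w (V i w * V j w)).
  apply: (has_mean_dom _ (has_meanD (mean_sqr i) (mean_sqr j))).
    exact: measurable_funM.
  move=> w; rewrite normrM -(real_normK (num_real (V i w))).
  rewrite -(real_normK (num_real (V j w))).
  have := normr_ge0 (V i w); have := normr_ge0 (V j w).
  move: `|V i w| `|V j w| => x y x0 y0.
  by have := sqr_ge0 (x - y); have := mulr_ge0 x0 y0; lra.
move=> intV _; split => //.
by have E := EXX ij; rewrite unlock in E; rewrite /Rintegral E.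
Qed.

Let stable_shift : exists2 c : 'I_3 -> R, (forall i, c i = 0) &
  forall F : 3.-tuple R -> R, unit_fun F ->
  \int[P]_w' (\int[P]_w F (scaled_sum (X w') (X w))) =
  \int[P]_w F [tuple tnth (X w) i + c i | i < 3].
Proof.
have [c stab] := jointly_gaussian_stable mX gX; exists c => // i.
apply: (drift0 (mV i) (mean_coord i)) => u uu.
have uF : unit_fun (fun t : 3.-tuple R => u (tnth t i)).
  by apply: (unit_comp uu); exact: measurable_tnth.
have := stab _ uF.
under eq_Rintegral do under eq_Rintegral do rewrite tnth_mktuple.
by under [RHS]eq_Rintegral do rewrite tnth_mktuple.
Qed.

Let stable_coord i j k : stable3 P (V i) (V j) (V k).
Proof.
move=> F uF; have [c c0 stab] := stable_shift.
have uG : unit_fun (fun t : 3.-tuple R => F (tnth t i, tnth t j, tnth t k)).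
  apply: (unit_comp uF); apply: measurable_fun_pair; last exact: measurable_tnth.
  by apply: measurable_fun_pair; exact: measurable_tnth.
have := stab _ uG.
under eq_Rintegral do under eq_Rintegral do rewrite !tnth_mktuple.
move=> ->; apply: eq_Rintegral => w _.
by rewrite !tnth_mktuple !c0 !addr0.
Qed.

Lemma prod_bound_gaussian i j k : i != j -> j != k -> i != k ->
  prod_bound P (fun w => tnth (X w) i) (fun w => tnth (X w) j) (fun w => tnth (X w) k).
Proof.
move=> ij jk ik; apply: prod_bound_c11; [exact: mV|exact: mV|exact: mV|] => C C0.
apply: (rev_holder1 (mV i) (mV j) (mV k)) => //; exact: mean_prod.
Qed.

End Reduction.

(** * Transfer to the copies and the final bound *)

Lemma prod_bound_same_law (d1 d2 : measure_display) (T1 : measurableType d1)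
    (T2 : measurableType d2) (R : realType) (P1 : probability T1 R)
    (P2 : probability T2 R) p (X1 : T1 -> p.-tuple R) (X2 : T2 -> p.-tuple R) i j k :
  measurable_fun setT X1 -> measurable_fun setT X2 -> same_law P1 P2 X1 X2 ->
  prod_bound P2 (fun w => tnth (X2 w) i) (fun w => tnth (X2 w) j)
    (fun w => tnth (X2 w) k) ->
  prod_bound P1 (fun w => tnth (X1 w) i) (fun w => tnth (X1 w) j)
    (fun w => tnth (X1 w) k).
Proof.
move=> m1 m2 law PB f g h uf ug uh.
have ut (q : 'I_p) u : unit_fun u -> unit_fun (fun t : p.-tuple R => u (tnth t q) : R).
  by move=> uu; apply: (unit_comp uu); exact: measurable_tnth.
rewrite (mean_same_law m1 m2 law (ut i f uf)) (mean_same_law m1 m2 law (ut j g ug)).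
rewrite (mean_same_law m1 m2 law (ut k h uh)).
rewrite (mean_same_law m1 m2 law (unitM (unitM (unitX 6 (ut i f uf))
  (unitX 6 (ut j g ug))) (unitX 6 (ut k h uh)))).
exact: PB.
Qed.

(** Summing the hypothesis over both signs gives eps <= 1/2. If some p i true is below eps, then p i
    false is at least 1 - eps >= eps, and for any other j the hypothesis forces p j false above
    eps. *)
Lemma common_sign (R : realFieldType) (eps : R) (p : 'I_3 -> bool -> R) :
  (forall i, p i true + p i false = 1) ->
  (forall i j b, i != j -> 2 * eps <= p i b + p j (~~ b)) ->
  exists b, forall i, eps <= p i b.
Proof.
move=> p1 pe.
pose j0 : 'I_3 := ord0; pose j1 : 'I_3 := lift ord0 ord0.
have j01 : j0 != j1 by [].
have eps2 : eps <= 1 / 2.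
  have := (pe j0 j1 true j01, pe j0 j1 false j01, p1 j0, p1 j1) => /=.
  by case=> -[[? ?] ?] ?; lra.
have [all1|] := boolP [forall i, eps <= p i true].
  by exists true => i; exact: (forallP all1).
rewrite negb_forall => /existsP[i]; rewrite -ltNge => pi.
exists false => j; have [->|ij] := eqVneq j i; first by have := p1 i; lra.
by rewrite eq_sym in ij; have := pe i j true ij => /=; lra.
Qed.

Lemma paradox_bound_pow (R : realType) (eps : R) : 0 < eps ->
  paradox_bound eps ((eps / 2) ^+ 18).
Proof.
move=> eps0 n _ d T P N Ncopy gN EN EN2 ENN law indN phi mphi phi1 calN hyp.
have mN : measurable_fun setT N by exact: measurable_funPT.
have mNc k : measurable_fun setT (Ncopy k : T -> 3.-tuple R) by exact: measurable_funPT.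
have mc i : measurable_fun setT (calN i) by exact: measurable_coordinates.
pose s (b : bool) : R := if b then 1 else -1.
have mpre i b : measurable (phi i @^-1` [set s b]).
  by rewrite -[X in measurable X]setTI; exact: mphi.
have mev i b : measurable [set w | phi i (calN i w) = s b].
  have := mc i measurableT _ (mpre i b); rewrite setTI; exact.
pose p i b := \int[P]_w \1_(phi i @^-1` [set s b]) (calN i w).
have ue i b : unit_fun (\1_(phi i @^-1` [set s b]) : n.-tuple R -> R) by exact: unit_indic.
have pE i b : P [set w | phi i (calN i w) = s b] = (p i b)%:E.
  rewrite /p /Rintegral fineK; last first.
    apply: (@integrable_fin_num _ _ _ P setT) => //.
    exact: (unit_integrable P (unit_comp (ue i b) (mc i))).
  transitivity (\int[P]_w (\1_[set w | phi i (calN i w) = s b] w)%:E)%E.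
    by rewrite integral_indic// setIT.
  by apply: eq_integral.
have [b pb] : exists b, forall i, eps <= p i b.
  apply: common_sign => [i|i j b ij].
    have := has_meanD (has_mean_unit P (unit_comp (ue i true) (mc i)))
      (has_mean_unit P (unit_comp (ue i false) (mc i))).
    case=> _ <-; rewrite -[RHS](mean_cst P); apply: eq_Rintegral => w _.
    rewrite /= !indicE; have neq : (1 == -1 :> R) = false.
      by apply/negbTE; rewrite -subr_eq0 opprK gt_eqF.
    case: (phi1 i (calN i w)) => e.
      rewrite memNset ?mem_set/= ?add0r// e => /eqP.
      by rewrite eq_sym neq.
    by rewrite mem_set ?memNset/= ?addr0// e => /eqP; rewrite neq.
  have := hyp i j (s b) ij; rewrite pE.
  have -> : - s b = s (~~ b) by rewrite /s; case: b => //=; rewrite opprK.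
  rewrite pE -EFinD lee_fin; apply.
  by rewrite /s; case: b; [right|left].
pose j0 : 'I_3 := ord0; pose j1 : 'I_3 := lift ord0 ord0; pose j2 : 'I_3 := ord_max.
have PBN := prod_bound_gaussian mN gN EN EN2 ENN (isT : j0 != j1) (isT : j1 != j2)
  (isT : j0 != j2).
have PBc k := prod_bound_same_law (mNc k) mN (law k) PBN.
have := prod_bound_coordinates mNc indN PBc (ue j0 b) (ue j1 b) (ue j2 b).
rewrite -/calN -!/(p _ _) => low.
have eps18 : (eps / 2) ^+ 18 <= p j0 b ^+ 6 * p j1 b ^+ 6 * p j2 b ^+ 6.
  have le6 i : (eps / 2) ^+ 6 <= p i b ^+ 6.
    rewrite lerXn2r ?nnegrE ?divr_ge0 ?(ltW eps0)//.
      exact: le_trans (ltW eps0) (pb i).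
    by apply: le_trans (pb i); lra.
  have e60 : 0 <= (eps / 2) ^+ 6 by rewrite exprn_ge0// divr_ge0 ?(ltW eps0).
  rewrite (_ : _ ^+ 18 = (eps / 2) ^+ 6 * (eps / 2) ^+ 6 * (eps / 2) ^+ 6); last by ring.
  apply: ler_pM; [exact: mulr_ge0|exact: e60| |exact: le6].
  by apply: ler_pM; [exact: e60|exact: e60|exact: le6|exact: le6].
apply: (@le_trans _ _ (p j0 b ^+ 6 * p j1 b ^+ 6 * p j2 b ^+ 6)%:E); first by rewrite lee_fin.
pose ev b' i := [set w | phi i (calN i w) = s b'].
pose all_ev b' := ev b' j0 `&` ev b' j1 `&` ev b' j2.
have mall b' : measurable (all_ev b').
  by apply: measurableI; [apply: measurableI|]; exact: mev.
have all_evE b' w : all_ev b' w -> forall i, phi i (calN i w) = s b'.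
  move=> [[e0 e1] e2] i.
  have [->//|->//|->//] : [\/ i = j0, i = j1 | i = j2].
  by case: i => [[|[|[|//]]] i3]; [apply: Or31|apply: Or32|apply: Or33]; exact: val_inj.
apply: (@le_trans _ _ (P (all_ev b))).
  apply: (@le_trans _ _ (\int[P]_w \1_(all_ev b) w)%:E).
    (* An indicator is its own sixth power, so the integrand in [low] is the indicator of
       [all_ev b]. *)
    rewrite lee_fin; apply: (le_trans low); rewrite le_eqVlt; apply/orP; left; apply/eqP.
    apply: eq_Rintegral => w _; rewrite !indicE !in_setI.
    have memE i : (calN i w \in phi i @^-1` [set s b]) = (w \in ev b i) by [].
    rewrite !memE; case: (w \in ev b j0); case: (w \in ev b j1);
      case: (w \in ev b j2) => /=; by rewrite ?expr0n ?expr1n /= ?mulr0 ?mul0r ?mulr1.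
  rewrite /Rintegral fineK; last first.
    apply: (@integrable_fin_num _ _ _ P setT) => //.
    exact: (unit_integrable P (unit_indic R (mall b))).
  by rewrite integral_indic// setIT.
apply: le_measure; rewrite ?inE//; last first.
  by move=> w /all_evE allw i j; rewrite !allw.
(* Since the values are -1 or 1, agreement splits into the two constant patterns, which shows that
   this event is measurable. *)
rewrite (_ : [set w | _] = all_ev true `|` all_ev false); first exact: measurableU.
apply/seteqP; split => [w same|w [] /all_evE allw i j]; last 2 first.
- by rewrite !allw.
- by rewrite !allw.
case: (phi1 j0 (calN j0 w)) => e; [right|left]; split; [split| |split|];
  by rewrite /ev /= /s -e; exact: same.
Qed.

Theorem theorem3p8 (R : realType) (eps : R) (heps : 0 < eps) :
  (exists delta : R, 0 < delta /\ paradox_bound eps delta) /\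
  paradox_bound eps ((eps / 2) ^+ 18).
Proof.
have bound := paradox_bound_pow heps.
split; last exact: bound.
by exists ((eps / 2) ^+ 18); rewrite exprn_gt0// divr_gt0.
Qed.
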